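(* Let $\alpha_2<\alpha_1\le0$, $\kappa>0$, $\omega_1,\omega_2\in\mathbb{R}$ with $\gamma=\omega_1-\omega_2\ge0$. Then for almost every initial datum, the solution of $$\dot z_1=(\alpha_1+\mathrm{i}\omega_1-|z_1|^2)z_1+\tfrac{\kappa}{2}(z_2-z_1),\qquad \dot z_2=(\alpha_2+\mathrm{i}\omega_2-|z_2|^2)z_2+\tfrac{\kappa}{2}(z_1-z_2)$$ converges to Amplitude Death at an exponential rate, while the phase difference $\Phi(t)$ converges to a fixed value (Phase-Locking).
   Context: $z_j(t)=r_j(t)e^{\mathrm{i}\phi_j(t)}\in\mathbb{C}$ with $r_j=|z_j|$, and $\Phi=\phi_1-\phi_2$. Amplitude Death: $r_1(t),r_2(t)\to0$ as $t\to\infty$. *)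

(* Defs.v *)
From HB Require Import structures.
From mathcomp Require Import all_boot all_order all_algebra.
From mathcomp Require Import all_classical all_reals all_analysis.
From mathcomp Require Import complex.

Set Implicit Arguments.
Unset Strict Implicit.
Unset Printing Implicit Defensive.

Import Order.TTheory GRing.Theory Num.Theory.
Import numFieldNormedType.Exports.
Local Open Scope classical_set_scope.
Local Open Scope complex_scope.
Local Open Scope ring_scope.

(* The norm of the ring R[i] is R[i]-valued, so the topology that the library
   puts on R[i] makes it a normed module over R[i], not over R. Continuity and
   differentiability of a curve R -> R[i] are therefore taken componentwise;
   for the same reason the modulus is the R-valued normc. *)
Definition ccontinuous_ge0 (R : realType) (z : R -> R[i]) : Prop :=
  {within `[0, +oo[, continuous (fun t : R => complex.Re (z t))} /\
  {within `[0, +oo[, continuous (fun t : R => complex.Im (z t))}.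

Definition is_cderive (R : realType) (z : R -> R[i]) (t : R) (v : R[i]) : Prop :=
  is_derive t 1 (fun s => complex.Re (z s)) (complex.Re v) /\
  is_derive t 1 (fun s => complex.Im (z s)) (complex.Im v).

(* Right-hand side of the equation for z, coupled to the other oscillator w. *)
Definition SL_field (R : realType) (alpha omega kappa : R) (z w : R[i]) : R[i] :=
  ((alpha +i* omega) - (Normc.normc z ^+ 2)%:C) * z + (kappa / 2)%:C * (w - z).

(* Forward solution on [0, +oo[: at t = 0 only continuity is required, since
   the values at negative times are irrelevant. The point
   x0 = ((x1, y1), (x2, y2)) encodes the initial datum (x1 + i y1, x2 + i y2). *)
Definition SL_solution (R : realType)
    (alpha1 alpha2 omega1 omega2 kappa : R) (x0 : (R * R) * (R * R))
    (z1 z2 : R -> R[i]) : Prop :=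
  [/\ ccontinuous_ge0 z1 /\ ccontinuous_ge0 z2,
      z1 0 = x0.1.1 +i* x0.1.2,
      z2 0 = x0.2.1 +i* x0.2.2 &
      forall t : R, 0 < t ->
        is_cderive z1 t (SL_field alpha1 omega1 kappa (z1 t) (z2 t)) /\
        is_cderive z2 t (SL_field alpha2 omega2 kappa (z2 t) (z1 t))].

Definition amplitude_death (R : realType) (z1 z2 : R -> R[i]) : Prop :=
  Normc.normc (z1 t) @[t --> +oo] --> (0 : R) /\
  Normc.normc (z2 t) @[t --> +oo] --> (0 : R).

Definition exp_decay (R : realType) (lambda : R) (z1 z2 : R -> R[i]) : Prop :=
  exists C : R, forall t : R, 0 <= t ->
    Normc.normc (z1 t) <= C * expR (- (lambda * t)) /\
    Normc.normc (z2 t) <= C * expR (- (lambda * t)).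

(* phi is a continuous phase of z along [0, +oo[. The curve is required not to
   vanish, as the phase is undefined at 0; phi is then determined by z up to a
   constant integer multiple of 2 pi. *)
Definition is_phase (R : realType) (z : R -> R[i]) (phi : R -> R) : Prop :=
  {within `[0, +oo[, continuous phi} /\
  forall t : R, 0 <= t ->
    z t != 0 /\ z t = (Normc.normc (z t))%:C * (cos (phi t) +i* sin (phi t)).

(* Since each phase is determined up to a constant in 2 pi Z, this says that
   Phi = phi1 - phi2 converges to Phi_lim modulo 2 pi for any choice of phases. *)
Definition phase_locking (R : realType) (z1 z2 : R -> R[i]) (Phi_lim : R) : Prop :=
  exists phi1 phi2 : R -> R,
    [/\ is_phase z1 phi1, is_phase z2 phi2 &
        (phi1 t - phi2 t) @[t --> +oo] --> Phi_lim].

Lemma product_measure_sigma_finite (d1 d2 : measure_display)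
    (T1 : measurableType d1) (T2 : measurableType d2) (R : realType)
    (m1 : {sigma_finite_measure set T1 -> \bar R})
    (m2 : {sigma_finite_measure set T2 -> \bar R}) :
  sigma_finite setT (m1 \x m2)%E.
Proof.
have /sigma_finiteP[F [TF ndF Foo]] := sigma_finiteT m1.
have /sigma_finiteP[G [TG ndG Goo]] := sigma_finiteT m2.
exists (fun n => F n `*` G n).
  rewrite -setXTT TF TG predeqE => -[x y]; split.
    move=> [/= [n _ Fnx] [k _ Gky]]; exists (maxn n k) => //; split.
    - by move: x Fnx; exact/subsetPset/ndF/leq_maxl.
    - by move: y Gky; exact/subsetPset/ndG/leq_maxr.
  by move=> [n _ []/= ? ?]; split; exists n.
move=> k; have [? ?] := Foo k; have [? ?] := Goo k.
split; first exact: measurableX.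
by rewrite product_measure1E// lte_mul_pinfty// ge0_fin_numE.
Qed.

Definition lebesgue2 (R : realType) :
    set (measurableTypeR R * measurableTypeR R) -> \bar R :=
  (@lebesgue_measure R \x @lebesgue_measure R)%E.

(* The sigma-finite instance that the library infers on a product is the one
   for subprobabilities, hence the explicit declarations below. *)
HB.instance Definition _ (R : realType) := Measure.on (@lebesgue2 R).
HB.instance Definition _ (R : realType) :=
  Measure_isSigmaFinite.Build _ _ _ (@lebesgue2 R)
    (product_measure_sigma_finite (@lebesgue_measure R) (@lebesgue_measure R)).

(* Lebesgue measure on C^2 = R^4. *)
Definition lebesgue4 (R : realType) :
    set ((measurableTypeR R * measurableTypeR R) *
         (measurableTypeR R * measurableTypeR R)) -> \bar R :=
  (@lebesgue2 R \x @lebesgue2 R)%E.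

HB.instance Definition _ (R : realType) := Measure.on (@lebesgue4 R).
HB.instance Definition _ (R : realType) :=
  Measure_isSigmaFinite.Build _ _ _ (@lebesgue4 R)
    (product_measure_sigma_finite (@lebesgue2 R) (@lebesgue2 R)).

(* Main.v *)
(* The energy |z1|^2 + |z2|^2 is a strict Lyapunov function, which gives
   existence for all times and the exponential decay. Near the origin the
   linear part dominates; its two eigenvalues have different real parts, so the
   modulus of the slow eigencoordinate either stays below that of the fast one
   for ever or eventually dominates it exponentially. In the second case the
   solution aligns with the slow eigenvector, whose components are nonzero, and
   the phase difference converges to their relative argument.

   The initial data to be excluded are those of the first case and those whose
   orbit meets z1 = 0 or z2 = 0. Two solutions of the first case are at a time n
   at a distance controlled by their fast coordinates alone; an orbit of the
   second kind is determined by its hitting time and the value of the other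
   oscillator at that time. Since the flow is Lipschitz backwards in time on
   bounded sets, the exceptional set is a countable union of sets with a
   parametrization by at most three real parameters that is Lipschitz, hence it
   is negligible in R^4. *)

Require Import Defs.
From HB Require Import structures.
From mathcomp Require Import all_boot all_order all_algebra.
From mathcomp Require Import all_classical all_reals all_analysis.
From mathcomp Require Import complex.
From mathcomp Require Import ring lra.

Set Implicit Arguments.
Unset Strict Implicit.
Unset Printing Implicit Defensive.

Import Order.TTheory GRing.Theory Num.Theory.
Import numFieldNormedType.Exports.
Local Open Scope classical_set_scope.
Local Open Scope ring_scope.

(** Neither a flow nor an invariant manifold is constructed. Everything rests on differential
    inequalities for the difference of two arbitrary solutions, in slow and fast coordinates; taking
    the zero solution as the second one yields the estimates for a single solution. No regularity of
    the exceptional sets has to be established: their covers by cubes are measurable.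

    The obstacle is that the cubic term is not small at time 0. Energy decay pushes it below the
    spectral gap after a time that depends only on a bound for the initial energy, which is why the
    exceptional sets are cut along integer bounds [N] of that energy. The gap comes from
    [alpha2 < alpha1]: the half difference [delta] of the diagonal entries has positive real part,
    so [delta ^+ 2 + k ^+ 2], with [k = kappa / 2], has a square root [mu] with positive real part.
    With [e = mu - delta] the slow eigenvector is [(k, e)], hence [z2 / z1] tends to [e / k] and the
    limit of [phi1 - phi2] is minus the argument of [e], the same for all data. *)

Section Calculus.
Variable R : realType.
Implicit Types (a b c t : R) (f g df dg : R -> R).

(** No derivative is asked for at [a], because a forward solution is only continuous at time 0.
    Monotonicity arguments on the closed half line need nothing more. *)
Definition dfrom a f df :=
  {within `[a, +oo[, continuous f} /\
  forall t, a < t -> is_derive t (1 : R) f (df t).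

Lemma dfrom_eq a f df dg :
  (forall t, a < t -> df t = dg t) -> dfrom a f df -> dfrom a f dg.
Proof. by move=> e [cf Df]; split=> // t at_; rewrite -e//; exact: Df. Qed.

Lemma dfromW a b f df : a <= b -> dfrom a f df -> dfrom b f df.
Proof.
move=> ab [cf Df]; split; last by move=> t bt; apply: Df; exact: le_lt_trans bt.
by apply: continuous_subspaceW cf; apply: subset_itvr; rewrite bnd_simp.
Qed.

Lemma dfrom_derive a f df :
  (forall t, is_derive t (1 : R) f (df t)) -> dfrom a f df.
Proof.
move=> Df; split=> //; apply: continuous_subspaceT => t.
exact/differentiable_continuous/derivable1_diffP.
Qed.

Lemma dfrom_cst a c : dfrom a (fun=> c) (fun=> 0).
Proof. by apply: dfrom_derive => t; exact: is_derive_cst. Qed.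

Lemma dfromD a f df g dg : dfrom a f df -> dfrom a g dg ->
  dfrom a (fun t => f t + g t) (fun t => df t + dg t).
Proof.
move=> [cf Df] [cg Dg]; split=> [x|t at_].
  by apply: continuousD; [exact: cf|exact: cg].
by have := is_deriveD (Df t at_) (Dg t at_).
Qed.

Lemma dfromN a f df : dfrom a f df -> dfrom a (fun t => - f t) (fun t => - df t).
Proof.
move=> [cf Df]; split=> [x|t at_]; first by apply: continuousN; exact: cf.
by have := is_deriveN (Df t at_).
Qed.

Lemma dfromB a f df g dg : dfrom a f df -> dfrom a g dg ->
  dfrom a (fun t => f t - g t) (fun t => df t - dg t).
Proof. by move=> Df Dg; apply: dfromD => //; exact: dfromN. Qed.

Lemma dfromM a f df g dg : dfrom a f df -> dfrom a g dg ->
  dfrom a (fun t => f t * g t) (fun t => df t * g t + f t * dg t).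
Proof.
move=> [cf Df] [cg Dg]; split=> [x|t at_].
  by apply: continuousM; [exact: cf|exact: cg].
have -> : df t * g t + f t * dg t = f t *: dg t + g t *: df t.
  by rewrite /GRing.scale/= addrC (mulrC (g t)).
exact: is_deriveM (Df t at_) (Dg t at_).
Qed.

Lemma dfromZ a c f df : dfrom a f df ->
  dfrom a (fun t => c * f t) (fun t => c * df t).
Proof.
move=> Df; apply: dfrom_eq (dfromM (dfrom_cst a c) Df) => t _.
by rewrite mul0r add0r.
Qed.

Lemma dfromX2 a f df : dfrom a f df ->
  dfrom a (fun t => f t ^+ 2) (fun t => 2 * f t * df t).
Proof.
move=> Df; apply: dfrom_eq (dfromM Df Df) => t _; ring.
Qed.

Lemma dfrom_comp a (h dh f df : R -> R) :
  (forall t, a <= t -> is_derive (f t) (1 : R) h (dh (f t))) ->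
  dfrom a f df -> dfrom a (fun t => h (f t)) (fun t => df t * dh (f t)).
Proof.
move=> Dh [cf Df]; split=> [|t at_]; last first.
  rewrite mulrC; have Dht := Dh t (ltW at_); have Dft := Df t at_.
  exact: is_derive1_comp.
have ch t : a <= t -> {for f t, continuous h}.
  move=> /Dh ?; exact/differentiable_continuous/derivable1_diffP.
move/continuous_within_itvcyP : cf => [cf cfa].
apply/continuous_within_itvcyP; split.
  move=> t; rewrite in_itv/= andbT => at_; apply: continuous_comp.
    by apply: cf; rewrite in_itv/= at_.
  exact/ch/ltW.
by apply: cvg_comp cfa _; exact: ch.
Qed.

Lemma dfrom_expR a c : dfrom a (fun t => expR (c * t)) (fun t => c * expR (c * t)).
Proof.
apply: (@dfrom_comp _ expR expR (fun t => c * t) (fun=> c)).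
apply: dfrom_derive => t.
have := is_deriveZ (f := id) c (is_derive_id t (1 : R)).
rewrite /GRing.scale/= mulr1; apply.
Qed.

Lemma dfromV a f df : (forall t, a <= t -> f t != 0) -> dfrom a f df ->
  dfrom a (fun t => (f t)^-1) (fun t => - df t / f t ^+ 2).
Proof.
move=> f0 Df; have := @dfrom_comp a GRing.inv (fun y => - y ^- 2) f df _ Df.
have H t : a <= t -> is_derive (f t) (1 : R) GRing.inv (- f t ^- 2).
  move=> /f0 ft0; have := is_deriveV (f := id) ft0 (is_derive_id (f t) (1 : R)).
  by rewrite /GRing.scale/= mulr1.
by move=> /(_ H); apply: dfrom_eq => t _; rewrite mulrN mulNr.
Qed.

Lemma dfrom_ndecr a f df : dfrom a f df ->
  (forall t, a < t -> 0 <= df t) ->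
  forall s t, a <= s -> s <= t -> f s <= f t.
Proof.
move=> [cf Df] df0; apply: ger0_derive1_ndecry => // t; rewrite in_itv/= andbT.
  by move=> /Df ?.
by move=> at_; have Dt := Df t at_; rewrite derive1E derive_val df0.
Qed.

Lemma dfrom_nincr a f df : dfrom a f df ->
  (forall t, a < t -> df t <= 0) ->
  forall s t, a <= s -> s <= t -> f t <= f s.
Proof.
move=> /dfromN Df df0 s t as_ st; rewrite -lerN2.
by apply: (dfrom_ndecr Df) => // r ar; rewrite oppr_ge0 df0.
Qed.

Lemma dfrom_eq0 a f df : dfrom a f df ->
  (forall t, a < t -> df t = 0) -> forall t, a <= t -> f t = f a.
Proof.
move=> Df df0 t at_; apply/eqP; rewrite eq_le.
rewrite (dfrom_nincr Df) ?(dfrom_ndecr Df)// => r /df0 ->//.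
Qed.

(** Grönwall's inequality from below: the hypothesis says that [expR (- c * t) * f t] has a
    nonnegative derivative. *)
Lemma dfrom_expR_ge a c f df : dfrom a f df ->
  (forall t, a < t -> c * f t <= df t) ->
  forall s t, a <= s -> s <= t -> f s * expR (c * (t - s)) <= f t.
Proof.
move=> Df H s t as_ st.
have D := dfromM (dfrom_expR a (- c)) Df.
have := @dfrom_ndecr _ _ _ D _ s t as_ st.
have -> : expR (c * (t - s)) = expR (- c * s) * (expR (- c * t))^-1.
  by rewrite -expRN -expRD; congr expR; ring.
rewrite mulrA [_ * _^-1]mulrC ler_pdivrMl ?expR_gt0// [f s * _]mulrC; apply.
move=> r /H; have := expR_gt0 (- c * r); set E := expR _.
move: (f r) (df r) => x y E0 xy.
have -> : - c * E * x + E * y = E * (y - c * x) by ring.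
by rewrite mulr_ge0 ?(ltW E0) ?subr_ge0.
Qed.

Lemma dfrom_expR_le a c f df : dfrom a f df ->
  (forall t, a < t -> df t <= c * f t) ->
  forall s t, a <= s -> s <= t -> f t <= f s * expR (c * (t - s)).
Proof.
move=> Df H s t as_ st; rewrite -lerN2 -mulNr.
apply: (dfrom_expR_ge (dfromN Df)) => // r /H.
by rewrite mulrN lerN2.
Qed.

(** Freezing [f] at its value at 0 extends it continuously to the whole line, where the fundamental
    theorem of calculus applies. *)
Lemma continuous_ge0_maxr f :
  {within `[0, +oo[, continuous f} -> continuous (fun t => f (Num.max t 0)).
Proof.
move=> /continuous_within_itvcyP[cf cf0] t.
have cm : {for t, continuous (fun s : R => Num.max s 0)}.
  by apply: continuous_max; [exact: cvg_id|exact: cvg_cst].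
have [t0|t0|t0] := ltgtP t 0.
- rewrite /continuous_at (max_r (ltW t0)).
  apply: cvg_near_cst; near=> s.
  by rewrite max_r//; apply/ltW; near: s; exact: lt_nbhsl.
- apply: continuous_comp cm _; rewrite (max_l (ltW t0)).
  by apply: cf; rewrite in_itv/= t0.
- rewrite /continuous_at t0 maxxx; apply/cvgrPdist_lt => e e0.
  have /cvgrPdist_lt/(_ e e0) := cf0; rewrite near_withinE => H.
  near=> s; have [s0|s0] := leP s 0; first by rewrite subrr normr0.
  by move: s0; near: s.
Unshelve. all: by end_near. Qed.

Lemma antiderivative f : {within `[0, +oo[, continuous f} ->
  exists2 F, F 0 = 0 & dfrom 0 F f.
Proof.
move=> cf; set g := fun t => f (Num.max t 0).
have cg : continuous g by exact: continuous_ge0_maxr.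
(* Starting at -1 makes 0 an interior point, so [G] is differentiable, hence continuous, at 0
   too. *)
pose G t := (\int[lebesgue_measure]_(s in `[-1, t]) g s)%R.
have DG t : -1 < t -> is_derive t (1 : R) G (g t).
  move=> t1; have [||//|//|] := @continuous_FTC1 _ g (BLeft (-1)) t (t + 1).
  - by rewrite ltrDl.
  - by apply: continuous_compact_integrable; [exact: segment_compact|
      exact: continuous_subspaceT].
  - exact: cg.
  - by move=> dG gE; rewrite -gE derive1E; exact: derivableP.
have DF : dfrom 0 G f.
  split; last first.
    move=> t t0; have := DG t; rewrite /g max_l ?(ltW t0)//; apply; lra.
  apply: continuous_in_subspaceT => t; rewrite inE/= in_itv/= andbT => t0.
  have : is_derive t (1 : R) G (g t) by apply: DG; lra.
  by move=> ?; exact/differentiable_continuous/derivable1_diffP.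
exists (fun t => G t - G 0); first by rewrite subrr.
by apply: dfrom_eq (dfromB DF (dfrom_cst 0 (G 0))) => t _; rewrite subr0.
Qed.

Lemma dfrom_norm_le a f df g dg : dfrom a f df -> dfrom a g dg ->
  (forall t, a < t -> `|df t| <= dg t) ->
  forall t, a <= t -> `|f t - f a| <= g t - g a.
Proof.
move=> Df Dg H t at_; rewrite ler_norml; apply/andP; split.
  have := dfrom_ndecr (dfromD Df Dg) _ (lexx a) at_.
  have K s : a < s -> 0 <= df s + dg s by move=> /H; rewrite ler_norml; lra.
  by move=> /(_ K); lra.
have := dfrom_ndecr (dfromB Dg Df) _ (lexx a) at_.
have K s : a < s -> 0 <= dg s - df s by move=> /H; rewrite ler_norml; lra.
by move=> /(_ K); lra.
Qed.

Lemma cvg_expR_neg c : 0 < c -> expR (- c * t) @[t --> +oo] --> (0 : R).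
Proof.
move=> c0; have H : c * t @[t --> +oo] --> +oo.
  by apply: gt0_cvgMry => //; exact: cvg_id.
have := cvg_comp _ _ H (@cvgr_expR R).
by apply: cvg_trans; apply: near_eq_cvg; near=> t; rewrite /= mulNr.
Unshelve. all: by end_near.
Qed.

Lemma cvg_expR_bound a c C (l : R) f : 0 < c ->
  (forall t, a <= t -> `|f t - l| <= C * expR (- c * t)) ->
  f t @[t --> +oo] --> l.
Proof.
move=> c0 H; have H0 : C * expR (- c * t) @[t --> +oo] --> C * 0.
  by apply: cvgM (cvg_expR_neg c0); exact: cvg_cst.
rewrite mulr0 in H0; apply/cvgrPdist_le => e e0.
have /cvgrPdist_le/(_ e e0) := H0.
move=> {}H0; near=> t.
have at_ : a <= t by near: t; apply: nbhs_pinfty_ge; exact: num_real.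
rewrite distrC (le_trans (H t at_))//.
have : `|0 - C * expR (- c * t)| <= e by near: t.
by rewrite sub0r normrN; exact: le_trans (ler_norm _).
Unshelve. all: by end_near. Qed.

(** Let [g] be the tail integral of the bound. Then [f - g] is nondecreasing and [f + g]
    nonincreasing, so [f - g] is bounded above and converges, while [g] tends to 0. The truncation
    [Num.max t a] in [h] makes the monotonicity global. *)
Lemma dfrom_exp_cvg a c C f df : 0 < c -> dfrom a f df ->
  (forall t, a < t -> `|df t| <= C * expR (- c * t)) ->
  exists l : R, f t @[t --> +oo] --> l.
Proof.
move=> c0 Df H; pose g t := (C / c) * expR (- c * t).
pose h t := f (Num.max t a) - g (Num.max t a).
have Dg : dfrom a g (fun t => - C * expR (- c * t)).
  apply: dfrom_eq (dfromZ (C / c) (dfrom_expR a (- c))) => t _ /=.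
  by field; rewrite gt_eqF.
have Dm : forall t, a < t -> 0 <= df t - (- C * expR (- c * t)).
  by move=> t /H; rewrite ler_norml; lra.
have C0 : 0 <= C.
  have a1 : a < a + 1 by rewrite ltrDl.
  have := le_trans (normr_ge0 _) (H _ a1).
  by rewrite pmulr_lge0 ?expR_gt0.
have hnd : nondecreasing_fun h.
  move=> s t st; apply: (dfrom_ndecr (dfromB Df Dg) Dm).
    by rewrite le_max lexx orbT.
  by rewrite ge_max !le_max st lexx orbT.
have hub : has_ubound (range h).
  exists (f a + g a) => _ [t _ <-]; rewrite /h.
  have at_ : a <= Num.max t a by rewrite le_max lexx orbT.
  have := dfrom_nincr (dfromD Df Dg) _ (lexx a) at_.
  have K s : a < s -> df s + - C * expR (- c * s) <= 0.
    by move=> /H; rewrite ler_norml; lra.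
  move=> /(_ K) /=; have : 0 <= g (Num.max t a).
    by rewrite /g mulr_ge0 ?expR_ge0 ?divr_ge0 ?(ltW c0).
  lra.
have hl := nondecreasing_cvgr hnd hub.
exists (sup (range h) + (C / c) * 0).
have Hl : h t + C / c * expR (- c * t) @[t --> +oo] -->
    sup (range h) + C / c * 0.
  by apply: cvgD hl _; apply: cvgM (cvg_expR_neg c0); exact: cvg_cst.
apply: cvg_trans Hl; apply: near_eq_cvg; near=> t => /=.
rewrite -/(g t).
rewrite /h max_l ?subrK//; near: t; apply: nbhs_pinfty_ge; exact: num_real.
Unshelve. all: by end_near. Qed.

Lemma cos_sin_surj a b : a ^+ 2 + b ^+ 2 = 1 ->
  exists theta, cos theta = a /\ sin theta = b.
Proof.
move=> ab; have a1 : -1 <= a <= 1.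
  by rewrite -ler_norml -(@ler_pXn2r _ 2)// ?nnegrE// expr1n real_normK ?num_real//; nra.
have sE : sin (acos a) = `|b|.
  by rewrite sin_acos// -ab addrAC subrr add0r sqrtr_sqr.
have [b0|b0] := leP 0 b.
  by exists (acos a); rewrite acosK// sE ger0_norm.
by exists (- acos a); rewrite cosN sinN acosK// sE ltr0_norm// opprK.
Qed.

End Calculus.

(** * Null sets of R^4 by counting cubes *)

Section Negligible.
Variable R : realType.
Notation point := ((R * R) * (R * R))%type.
Implicit Types (x y : point) (p q : R * R * R).

Definition sqdist x y : R :=
  (x.1.1 - y.1.1) ^+ 2 + (x.1.2 - y.1.2) ^+ 2 +
  ((x.2.1 - y.2.1) ^+ 2 + (x.2.2 - y.2.2) ^+ 2).

Definition cube x (r : R) : set point :=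
  (`[x.1.1 - r, x.1.1 + r] `*` `[x.1.2 - r, x.1.2 + r]) `*`
  (`[x.2.1 - r, x.2.1 + r] `*` `[x.2.2 - r, x.2.2 + r]).

Lemma measurable_cube x r : measurable (cube x r : set
  ((measurableTypeR R * measurableTypeR R) *
   (measurableTypeR R * measurableTypeR R))).
Proof. by apply: measurableX; apply: measurableX; exact: measurable_itv. Qed.

Lemma lebesgue4_cube x (r : R) : 0 <= r ->
  @lebesgue4 R (cube x r) = ((2 * r) ^+ 4)%:E.
Proof.
move=> r0.
have L1 (c : R) : @lebesgue_measure R `[c - r, c + r] = (2 * r)%:E.
  rewrite lebesgue_measure_itv/= lte_fin.
  case: ltP => [_|]; first by rewrite -EFinB; congr EFin; ring.
  by move=> h; congr EFin; lra.
have L2 (c d : R) : @lebesgue2 R (`[c - r, c + r] `*` `[d - r, d + r]) =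
    ((2 * r) ^+ 2)%:E.
  rewrite /lebesgue2 product_measure1E; [|exact: measurable_itv..].
  transitivity ((2 * r)%:E * (2 * r)%:E)%E; last by rewrite -EFinM expr2.
  by congr (_ * _)%E; exact: L1.
rewrite /lebesgue4 product_measure1E; last 2 first.
- exact: measurableX (measurable_itv _) (measurable_itv _).
- exact: measurableX (measurable_itv _) (measurable_itv _).
transitivity (((2 * r) ^+ 2)%:E * ((2 * r) ^+ 2)%:E)%E.
  by congr (_ * _)%E; exact: L2.
by rewrite -EFinM -exprD.
Qed.

Lemma sqdist_cube x y (r : R) : 0 <= r -> sqdist x y <= r ^+ 2 -> cube x r y.
Proof.
move=> r0; case: x y => [[x1 x2] [x3 x4]] [[y1 y2] [y3 y4]].
rewrite /sqdist /cube/= => H.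
have K (u v w z : R) : (u - v) ^+ 2 + w + z <= r ^+ 2 -> 0 <= w -> 0 <= z ->
    v \in `[u - r, u + r].
  move=> h w0 z0; rewrite in_itv/= -ler_distlC.
  by rewrite -(@ler_pXn2r _ 2)// ?nnegrE// real_normK ?num_real//; lra.
have := (sqr_ge0 (x1 - y1), sqr_ge0 (x2 - y2), sqr_ge0 (x3 - y3), sqr_ge0 (x4 - y4)).
case=> [[[/= h1 h2] h3] h4].
split; split; rewrite /=.
- by apply: (K x1 y1 _ _ _ h2 (addr_ge0 h3 h4)).
- by apply: (K x2 y2 _ _ _ h1 (addr_ge0 h3 h4)); lra.
- by apply: (K x3 y3 _ _ _ h4 (addr_ge0 h1 h2)); lra.
- by apply: (K x4 y4 _ _ _ h3 (addr_ge0 h1 h2)); lra.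
Qed.

Lemma measure_bigsetU_seq_le d (T : measurableType d)
    (mu : {measure set T -> \bar R}) (I : Type) (s : seq I)
    (A : I -> set T) (c : R) : (forall i, measurable (A i)) ->
  (forall i, (mu (A i) <= c%:E)%E) ->
  (mu (\big[setU/set0]_(i <- s) A i) <= (c *+ size s)%:E)%E.
Proof.
move=> mA Ac; elim: s => [|i s ih]; first by rewrite big_nil measure0.
have mU : measurable (\big[setU/set0]_(i <- s) A i) by apply: bigsetU_measurable.
rewrite big_cons/= mulrS EFinD (le_trans (measureU2 _ _ _))//.
by apply: leeD; [exact: Ac|exact: ih].
Qed.

(* A subset of R^4 with an injective labelling in a bounded part of R^3 whose
   inverse is Lipschitz is covered by O(N^3) cubes of side O(1/N). *)
Lemma negligible_lipschitz_param (P : point -> R * R * R -> Prop) (K : nat)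
    (L : R) :
  (forall x p, P x p ->
    [/\ `|p.1.1| <= K%:R, `|p.1.2| <= K%:R & `|p.2| <= K%:R]) ->
  (forall x p y q (G : R), 0 <= G -> P x p -> P y q ->
    `|p.1.1 - q.1.1| <= G -> `|p.1.2 - q.1.2| <= G -> `|p.2 - q.2| <= G ->
    sqdist x y <= L * G ^+ 2) ->
  (@lebesgue4 R).-negligible [set x | exists p, P x p].
Proof.
move=> PK PL; set S := Num.sqrt L.
have S0 : 0 <= S by exact: sqrtr_ge0.
have LS : L <= S ^+ 2.
  have [L0|L0] := leP 0 L; first by rewrite sqr_sqrtr.
  by rewrite (le_trans (ltW L0))// sqr_ge0.
(* The label [lab N a] is the index of the cell of width [1 / N] of [[-K, K]] that contains [a]. The
   endpoint [a = K] gets the label [2 * K * N], hence the successor. *)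
pose m N := (2 * K * N).+1.
pose lab N (a : R) : nat := Num.truncn ((a + K%:R) * N%:R).
have labm N a : `|a| <= K%:R -> (lab N a < m N)%N.
  move=> aK; have a0 : 0 <= a + K%:R by move: aK; rewrite ler_norml; lra.
  rewrite /m ltnS /lab -(ler_nat R).
  have n0 : 0 <= (a + K%:R) * N%:R by rewrite mulr_ge0.
  have /andP[/le_trans + _] := truncn_itv n0; apply.
  rewrite 2!natrM; apply: ler_wpM2r => //.
  by move: aK; rewrite ler_norml; lra.
have labE N a b : (0 < N)%N -> `|a| <= K%:R -> `|b| <= K%:R ->
    lab N a = lab N b -> `|a - b| <= N%:R^-1.
  move=> N0 aK bK; rewrite /lab => e.
  have N0' : 0 < N%:R :> R by rewrite ltr0n.
  have nn (c : R) : `|c| <= K%:R -> 0 <= (c + K%:R) * N%:R.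
    by move=> cK; rewrite mulr_ge0//; move: cK; rewrite ler_norml; lra.
  have /andP[a1 a2] := truncn_itv (nn _ aK).
  have /andP[b1 b2] := truncn_itv (nn _ bK).
  rewrite -(ler_pM2r N0') mulVf ?gt_eqF//.
  rewrite -[X in _ * X](ger0_norm (ltW N0')) -normrM.
  rewrite -natr1 in a2 b2; rewrite e in a1 a2.
  by rewrite ler_norml; move: a1 a2 b1 b2; lra.
pose ok N (l : 'I_(m N) * 'I_(m N) * 'I_(m N)) x := exists p,
  [/\ P x p, lab N p.1.1 = l.1.1, lab N p.1.2 = l.1.2 & lab N p.2 = l.2].
(* Each occupied cell gets a cube around one chosen point of it. By the Lipschitz bound, every other
   point with the same labels is within [S / N] of that centre. *)
pose A N l : set point := if pselect (exists x, ok N l x) is left h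
  then cube (projT1 (cid h)) (S / N%:R) else set0.
have mA N l : measurable (A N l : set ((measurableTypeR R * measurableTypeR R) *
   (measurableTypeR R * measurableTypeR R))).
  by rewrite /A; case: pselect => // h; exact: measurable_cube.
have muA N l : (@lebesgue4 R (A N l) <= ((2 * (S / N%:R)) ^+ 4)%:E)%E.
  rewrite /A; case: pselect => [h|_]; first by rewrite lebesgue4_cube// divr_ge0.
  by rewrite measure0 lee_fin exprn_even_ge0.
pose U N : set point := \big[setU/set0]_(l <- enum {: 'I_(m N) * 'I_(m N) * 'I_(m N)}) A N l.
have mU N : measurable (U N : set ((measurableTypeR R * measurableTypeR R) *
   (measurableTypeR R * measurableTypeR R))) by apply: bigsetU_measurable.
have muU N : (0 < N)%N -> (@lebesgue4 R (U N) <=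
    ((2 * K%:R + 1) ^+ 3 * (2 * S) ^+ 4 / N%:R)%:E)%E.
  move=> N0; have := @measure_bigsetU_seq_le _ _ (@lebesgue4 R) _
    (enum {: 'I_(m N) * 'I_(m N) * 'I_(m N)}) _ _ (mA N) (muA N).
  move/le_trans; apply; rewrite lee_fin -cardE !card_prod card_ord -[leLHS]mulr_natl.
  have N0' : 0 < N%:R :> R by rewrite ltr0n.
  have N1 : 1 <= N%:R :> R by rewrite ler1n.
  have mN : (m N)%:R <= (2 * K%:R + 1) * N%:R :> R.
    by rewrite /m -addn1 natrD 2!natrM; lra.
  have -> : (2 * K%:R + 1) ^+ 3 * (2 * S) ^+ 4 / N%:R =
      ((2 * K%:R + 1) * N%:R) ^+ 3 * (2 * (S / N%:R)) ^+ 4 :> R.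
    by field; rewrite gt_eqF.
  rewrite ler_wpM2r ?exprn_even_ge0// !natrM -!expr2 -exprSr.
  by rewrite lerXn2r// ?nnegrE// (le_trans _ mN).
have EU N : (0 < N)%N -> [set x | exists p, P x p] `<=` U N.
  move=> N0 x [p Pxp]; have [p1 p2 p3] := PK _ _ Pxp.
  pose l := (Ordinal (labm N _ p1), Ordinal (labm N _ p2), Ordinal (labm N _ p3)).
  rewrite /U -bigcup_seq; exists l; first by rewrite /= mem_enum.
  rewrite /A; case: pselect => [h|]; last by case; exists x, p; split.
  case: (cid h) => y /= [q [Pyq e1 e2 e3]].
  have [q1 q2 q3] := PK _ _ Pyq.
  apply: sqdist_cube; first by rewrite divr_ge0.
  have nV : 0 <= N%:R^-1 :> R by rewrite invr_ge0.
  have := PL _ _ _ _ _ nV Pyq Pxp _ _ _.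
  move=> /(_ (labE _ _ _ N0 q1 p1 e1) (labE _ _ _ N0 q2 p2 e2)).
  move=> /(_ (labE _ _ _ N0 q3 p3 e3)) /le_trans; apply.
  by rewrite exprMn ler_wpM2r// sqr_ge0.
(* The cubes have volume of order [N ^- 4], so [U N] has measure of order [1 / N]; the shift avoids
   [N = 0]. *)
exists (\bigcap_N U N.+1); split.
- by apply: bigcap_measurable => // N _; exact: mU.
- apply/eqP; rewrite eq_le measure_ge0 andbT; apply/lee_addgt0Pr => e e0.
  rewrite add0e; set C := (2 * K%:R + 1) ^+ 3 * (2 * S) ^+ 4.
  pose N := Num.truncn (C / e).
  have N1 : C / e < N.+1%:R by exact: truncnS_gt.
  apply: (@le_trans _ _ (@lebesgue4 R (U N.+1))).
    apply: le_measure; rewrite ?inE//; last exact: bigcap_inf.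
    by apply: bigcap_measurable => // n _; exact: mU.
  apply: le_trans (muU _ _) _ => //.
  rewrite lee_fin -/C ler_pdivrMr ?ltr0n//.
  by move: N1; rewrite ltr_pdivrMr// mulrC => /ltW.
- by move=> x Ex N _; exact: EU.
Qed.

End Negligible.

(** * Global existence for globally Lipschitz systems *)

Section Picard.
Variable R : realType.
Implicit Types (t : R).

Lemma le_half_expn (a C : R) : (forall n, a <= C * 2^-1 ^+ n) -> a <= 0.
Proof.
move=> H; rewrite leNgt; apply/negP => a0.
have C0 : 0 < C by have := H 0; rewrite expr0 mulr1; exact: lt_le_trans.
pose n := Num.truncn (C / a).
have nC : C / a < n.+1%:R by exact: truncnS_gt.
have n2 : n.+1%:R <= 2 ^+ n :> R by rewrite -natrX ler_nat; exact: ltn_expl.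
have := H n; rewrite exprVn ler_pdivlMr ?exprn_gt0// leNgt => /negP; apply.
by rewrite mulrC -ltr_pdivrMr// (lt_le_trans nC).
Qed.

Lemma within_continuous_unif_limit (f : R -> R) :
  (forall t e : R, 0 <= t -> 0 < e -> exists2 g : R -> R,
    {within `[0, +oo[, continuous g} &
    forall s : R, 0 <= s -> s <= t + 1 -> `|f s - g s| <= e) ->
  {within `[0, +oo[, continuous f}.
Proof.
move=> H; apply/subspace_continuousP => t tA.
have t0 : 0 <= t by move: tA; rewrite /= in_itv/= andbT.
apply/cvgrPdist_le => e e0.
have e3 : 0 < e / 3 by rewrite divr_gt0.
have [g cg fg] := H t _ t0 e3.
have key s : 0 <= s -> s <= t + 1 -> `|g t - g s| <= e / 3 -> `|f t - f s| <= e.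
  move=> s0 st; have := fg _ s0 st; have := fg t t0 _.
  by rewrite lerDl ler01 => /(_ isT); rewrite !ler_norml; lra.
have /subspace_continuousP/(_ t tA)/cvgrPdist_le/(_ _ e3) := cg.
rewrite !near_withinE => gt; near=> s => sA; apply: key.
- by move: sA; rewrite /= in_itv/= andbT.
- by apply/ltW; near: s; apply: lt_nbhsl; rewrite ltrDl.
- by move: sA; near: s.
Unshelve. all: by end_near. Qed.

Variables (I : finType) (F : I -> (I -> R) -> R) (L : R).
Hypothesis L0 : 0 < L.
Hypothesis F_lip : forall i (a b : I -> R) (B : R),
  (forall j, `|a j - b j| <= B) -> `|F i a - F i b| <= L * B.
Variable x0 : I -> R.

Let cont (x : I -> R -> R) :=
  forall i, {within `[0, +oo[, continuous (x i)}.

Let cont_field x i : cont x ->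
  {within `[0, +oo[, continuous (fun t => F i (fun j => x j t))}.
Proof.
move=> cx; apply/subspace_continuousP => t tA; apply/cvgrPdist_le => e e0.
have e'0 : 0 < e / L by rewrite divr_gt0.
have H : \forall s \near within `[0, +oo[ (nbhs t), forall j, `|x j t - x j s| <= e / L.
  apply: filter_forall => j.
  by have /subspace_continuousP/(_ t tA)/cvgrPdist_le/(_ _ e'0) := cx j.
apply: filterS H => s H; rewrite (le_trans (F_lip _ H))//.
by rewrite mulrC divfK// gt_eqF.
Qed.

Let integral_step x : cont x -> exists y : I -> R -> R, forall i,
  y i 0 = x0 i /\ dfrom 0 (y i) (fun t => F i (fun j => x j t)).
Proof.
move=> cx.
have H i : exists yi : R -> R, yi 0 = x0 i /\ dfrom 0 yi (fun t => F i (fun j => x j t)).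
  have [G G0 DG] := antiderivative (@cont_field x i cx).
  exists (fun t => x0 i + G t); rewrite G0 addr0; split=> //.
  by apply: dfrom_eq (dfromD (dfrom_cst 0 (x0 i)) DG) => t _; rewrite add0r.
by have [y yP] := choice H; exists y.
Qed.

Let iterates : exists X : nat -> I -> R -> R,
  (forall i t, X 0 i t = x0 i) /\
  forall n i, X n.+1 i 0 = x0 i /\
    dfrom 0 (X n.+1 i) (fun t => F i (fun j => X n j t)).
Proof.
(* Choice needs a value at every [x], so continuity is moved inside the existential and a
   discontinuous [x] is sent to itself. *)
have H x : exists y : I -> R -> R, cont x -> forall i,
    y i 0 = x0 i /\ dfrom 0 (y i) (fun t => F i (fun j => x j t)).
  have [/integral_step[y yP]|nx] := pselect (cont x); first by exists y.
  by exists x => /nx.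
have [step stepP] := choice H.
pose X n := iter n step (fun i _ => x0 i); exists X; split=> //.
have cX n : cont (X n).
  elim: n => [|n ih] i; first by apply: continuous_subspaceT => t; exact: cvg_cst.
  by have [_ []] := stepP _ ih i.
by move=> n; exact: stepP.
Qed.

Let X := projT1 (cid iterates).
Let X0 i t : X 0 i t = x0 i.
Proof. by have [] := projT2 (cid iterates). Qed.
Let Xstart n i : X n i 0 = x0 i.
Proof.
by case: n => [|n]; [exact: X0|have [_ /(_ n i)[]] := projT2 (cid iterates)].
Qed.
Let DX n i : dfrom 0 (X n.+1 i) (fun t => F i (fun j => X n j t)).
Proof. by have [_ /(_ n i)[]] := projT2 (cid iterates). Qed.

Let cX n : cont (X n).
Proof.
case: n => [|n] i; last by have [] := DX n i.
have -> : X 0 i = cst (x0 i) by apply/funext => t; exact: X0.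
by apply: continuous_subspaceT => t; exact: cvg_cst.
Qed.

Let A := \sum_i `|F i x0|.
(** Chosen so that the derivative [A * expR (2 * L * t)] of [M * expR (2 * L * t)] dominates the
    speed of the first iterate. *)
Let M := A / (2 * L).
Let M0 : 0 <= M.
Proof. by rewrite divr_ge0 ?sumr_ge0// mulr_ge0// ltW. Qed.

Let dexp (C : R) : dfrom 0 (fun t => C * expR (2 * L * t))
  (fun t => C * (2 * L) * expR (2 * L * t)).
Proof.
by apply: dfrom_eq (dfromZ C (dfrom_expR 0 (2 * L))) => t _; rewrite mulrA.
Qed.

(** The weight [expR (2 * L * t)] (Bielecki's norm) makes integration of an [L]-Lipschitz field a
    contraction of factor 1/2 on the whole half line at once, so no short time intervals have to be
    glued. *)
Let X_cauchy n i t : 0 <= t ->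
  `|X n.+1 i t - X n i t| <= M * 2^-1 ^+ n * expR (2 * L * t).
Proof.
have drop (C a b : R) : 0 <= C -> a <= b - C -> a <= b by lra.
elim: n i t => [|n ih] i t t0.
  have := dfrom_norm_le (DX 0 i) (dexp M) _ t0.
  rewrite mulr0 expR0 mulr1 ?expr0 ?mulr1 (Xstart 1) X0 => H.
  apply: (drop M) => //; apply: H => s s0.
  have -> : (fun j => X 0 j s) = x0 by apply/funext => j; exact: X0.
  have -> : M * (2 * L) = A by rewrite /M divfK// mulf_neq0 ?gt_eqF.
  have FA : `|F i x0| <= A by rewrite /A (bigD1 i)//= lerDl sumr_ge0.
  rewrite (le_trans FA)// ler_peMr ?(le_trans _ FA)//.
  by rewrite -expR0 ler_expR !mulr_ge0 ?ltW.
have := dfrom_norm_le (dfromB (DX n.+1 i) (DX n i)) (dexp (M * 2^-1 ^+ n.+1)) _ t0.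
rewrite mulr0 expR0 mulr1 !Xstart subrr subr0 => H.
apply: (drop (M * 2^-1 ^+ n.+1)); first by rewrite mulr_ge0// exprn_ge0.
apply: H => s s0; have := F_lip i (fun j => ih j s (ltW s0)); move/le_trans; apply.
by rewrite exprS le_eqVlt; apply/orP; left; apply/eqP; field.
Qed.

(** The tail from [n] on of the geometric series of bounds in [X_cauchy]. *)
Let h n t := 2 * (M * 2^-1 ^+ n * expR (2 * L * t)).
Let hS n t : h n.+1 t = h n t - M * 2^-1 ^+ n * expR (2 * L * t).
Proof. by rewrite /h exprS; field. Qed.
Let h0 n t : 0 <= h n t.
Proof. rewrite /h; apply: mulr_ge0 => //; apply: mulr_ge0; last exact: expR_ge0.
by apply: mulr_ge0 => //; exact: exprn_ge0.
 Qed.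

(** For [0 <= t] the intervals of centre [X n i t] and radius [h n t] are nested; the limit of the
    iterates is taken as the supremum of their left endpoints. *)
Let x i t := sup (range (fun n => X n i t - h n t)).

Let X_lim n i t : 0 <= t -> `|X n i t - x i t| <= h n t.
Proof.
move=> t0.
have lo m k : X m i t - h m t <= X (m + k) i t - h (m + k) t.
  elim: k => [|k ih]; first by rewrite addn0.
  rewrite (le_trans ih)// addnS hS; have := X_cauchy (m + k) i t0.
  by rewrite ler_norml; lra.
have up m k : X (m + k) i t + h (m + k) t <= X m i t + h m t.
  elim: k => [|k ih]; first by rewrite addn0.
  rewrite (le_trans _ ih)// addnS hS; have := X_cauchy (m + k) i t0.
  by rewrite ler_norml; lra.
have lu m : X m i t - h m t <= X n i t + h n t.
  apply: (le_trans (lo m n)); rewrite (le_trans _ (up n m))// addnC.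
  by have := h0 (n + m) t; lra.
have ubx : ubound (range (fun n => X n i t - h n t)) (X n i t + h n t).
  by move=> _ [m _ <-].
have xu : x i t <= X n i t + h n t by apply: ge_sup => //; exists (X 0 i t - h 0 t), 0%N.
have lx : X n i t - h n t <= x i t.
  by apply: ub_le_sup; [exists (X n i t + h n t)|exists n].
by rewrite ler_norml; lra.
Qed.

Let cx : cont x.
Proof.
move=> i; apply: within_continuous_unif_limit => t e t0 e0.
have [n hn] : exists n, h n (t + 1) <= e.
  apply: contrapT => /forallNP H.
  have : e <= 0.
    apply: (@le_half_expn _ (2 * (M * expR (2 * L * (t + 1))))) => n.
    have /negP := H n; rewrite -ltNge => /ltW/le_trans; apply.
    by rewrite le_eqVlt; apply/orP; left; apply/eqP; rewrite /h; ring.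
  by rewrite leNgt e0.
exists (X n i) => [|s s0 st]; first exact: cX.
rewrite distrC (le_trans (X_lim n i s0))// (le_trans _ hn)// /h.
apply: ler_wpM2l => //; apply: ler_wpM2l.
  by apply: mulr_ge0 => //; exact: exprn_ge0.
by rewrite ler_expR; apply: ler_wpM2l => //; apply: mulr_ge0 => //; exact: ltW.
Qed.

Theorem picard_global : exists y : I -> R -> R, forall i,
  y i 0 = x0 i /\ dfrom 0 (y i) (fun t => F i (fun j => y j t)).
Proof.
(* One more Picard step applied to the limit [x]. Its distance to [X n.+1] is of order [2^-1 ^+ n],
   so [y] equals [x] on the half line and solves the equation. *)
have [y yP] := integral_step cx; exists y.
have yx i t : 0 <= t -> y i t = x i t.
  move=> t0; apply/eqP; rewrite -subr_eq0 -normr_le0.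
  apply: (@le_half_expn _ (2 * (M * expR (2 * L * t)))) => n.
  have [yi0 Dy] := yP i.
  have := dfrom_norm_le (dfromB Dy (DX n i)) (dexp (M * 2^-1 ^+ n)) _ t0.
  rewrite mulr0 expR0 mulr1 yi0 Xstart subrr subr0 => H.
  have H1 : `|y i t - X n.+1 i t| <= M * 2^-1 ^+ n * expR (2 * L * t) - M * 2^-1 ^+ n.
    apply: H => s s0; have B j : `|x j s - X n j s| <= h n s.
      by rewrite distrC; apply: X_lim; exact: ltW.
    rewrite (le_trans (F_lip i B))// le_eqVlt; apply/orP; left; apply/eqP.
    by rewrite /h; ring.
  have := X_lim n.+1 i t0; rewrite hS /h; move: H1.
  have : 0 <= M * 2^-1 ^+ n by rewrite mulr_ge0 ?exprn_ge0.
  rewrite !ler_norml; set E := expR _; set a := _ ^+ n; set b := M * a => ? ?.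
  have -> : 2 * (M * E) * a = 2 * (b * E) by rewrite /b; ring.
  lra.
move=> i; have [yi0 Dy] := yP i; split=> //; apply: dfrom_eq Dy => t t0.
by congr (F i _); apply/funext => j; rewrite yx// ltW.
Qed.

End Picard.

(** * Squared moduli and derivatives of complex curves *)

Section ComplexCurves.
Variable R : realType.
Local Notation C := R[i].
Implicit Types (z w x y : C) (r a : R) (f g df dg : R -> C).

(** Squared moduli keep the estimates polynomial, within reach of [ring] and [nra], and
    differentiable where a curve meets 0. *)
Definition nsq z : R := complex.Re z ^+ 2 + complex.Im z ^+ 2.
Definition dotc z w : R := complex.Re z * complex.Re w + complex.Im z * complex.Im w.

Lemma nsq_ge0 z : 0 <= nsq z.
Proof. by rewrite addr_ge0 ?sqr_ge0. Qed.

Lemma nsq0 : nsq 0 = 0.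
Proof. by rewrite /nsq /= expr0n addr0. Qed.

Lemma nsqM z w : nsq (z * w) = nsq z * nsq w.
Proof. by case: z => a b; case: w => c d; rewrite /nsq/=; ring. Qed.

Lemma nsqN z : nsq (- z) = nsq z.
Proof. by case: z => a b; rewrite /nsq/= !sqrrN. Qed.

Lemma nsq_real r : nsq r%:C%C = r ^+ 2.
Proof. by rewrite /nsq /= expr0n addr0. Qed.

Lemma nsqB z w : nsq (z - w) =
  (complex.Re z - complex.Re w) ^+ 2 + (complex.Im z - complex.Im w) ^+ 2.
Proof. by case: z; case: w. Qed.

Lemma nsqD_le z w : nsq (z + w) <= 2 * nsq z + 2 * nsq w.
Proof.
case: z => a b; case: w => c d; rewrite /nsq/=.
have := (sqr_ge0 (a - c), sqr_ge0 (b - d)); case=> /= h1 h2; nra.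
Qed.

Lemma nsqB_le z w : nsq (z - w) <= 2 * nsq z + 2 * nsq w.
Proof. by rewrite -(nsqN w) nsqD_le. Qed.

Lemma nsq_eq0 z : (nsq z == 0) = (z == 0).
Proof.
case: z => a b; rewrite /nsq paddr_eq0 ?sqr_ge0//= !sqrf_eq0.
by rewrite eq_complex.
Qed.

Lemma nsq_gt0 z : z != 0 -> 0 < nsq z.
Proof. by move=> z0; rewrite lt_neqAle nsq_ge0 andbT eq_sym nsq_eq0. Qed.

Lemma normc_nsq z : Normc.normc z = Num.sqrt (nsq z).
Proof. by case: z. Qed.

Lemma nsq_normc z : Normc.normc z ^+ 2 = nsq z.
Proof. by rewrite normc_nsq sqr_sqrtr ?nsq_ge0. Qed.

Lemma dotc_sqr_le z w : dotc z w ^+ 2 <= nsq z * nsq w.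
Proof.
case: z => a b; case: w => c d; rewrite /nsq /dotc/=.
have := sqr_ge0 (a * d - b * c); nra.
Qed.

Lemma dotc_le z w r : 0 <= r -> nsq z * nsq w <= r ^+ 2 -> `|dotc z w| <= r.
Proof.
move=> r0 H; rewrite -(@ler_pXn2r _ 2)// ?nnegrE// real_normK ?num_real//.
exact: le_trans (dotc_sqr_le z w) H.
Qed.

(** This is how the real parts of the eigenvalues become growth rates of squared coordinates. *)
Lemma dotcMl z w : dotc z (w * z) = complex.Re w * nsq z.
Proof. by case: z => a b; case: w => c d; rewrite /nsq /dotc/=; ring. Qed.

Lemma dotcB z w x : dotc z (w - x) = dotc z w - dotc z x.
Proof.
by case: z => a b; case: w => c d; case: x => e f; rewrite /dotc/=; ring.
Qed.

Lemma nsqB_sqr_le x y r : nsq x <= r -> nsq y <= r ->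
  (nsq x - nsq y) ^+ 2 <= 4 * r * nsq (x - y).
Proof.
move=> xr yr; have -> : nsq x - nsq y = dotc (x - y) (x + y).
  by case: x {xr} => a b; case: y {yr} => c d; rewrite /nsq /dotc/=; ring.
rewrite (le_trans (dotc_sqr_le _ _))// mulrC ler_wpM2r ?nsq_ge0//.
by have := nsqD_le x y; lra.
Qed.

Definition cubic z : C := (nsq z)%:C%C * z.

(** The difference is split into [nsq x * (x - y)] and [(nsq x - nsq y) * y], which contribute 1 and
    4 in units of [r ^+ 2]; squaring the sum doubles both. *)
Lemma cubic_lipschitz x y r : nsq x <= r -> nsq y <= r ->
  nsq (cubic x - cubic y) <= 10 * r ^+ 2 * nsq (x - y).
Proof.
move=> xr yr; have r0 : 0 <= r by rewrite (le_trans (nsq_ge0 x)).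
have -> : cubic x - cubic y =
    (nsq x)%:C%C * (x - y) + (nsq x - nsq y)%:C%C * y.
  by rewrite /cubic raddfB/=; ring.
rewrite (le_trans (nsqD_le _ _))// !nsqM !nsq_real.
have h1 : nsq x ^+ 2 <= r ^+ 2 by rewrite lerXn2r ?nnegrE ?nsq_ge0.
have h2 := nsqB_sqr_le xr yr.
have h3 : nsq x ^+ 2 * nsq (x - y) <= r ^+ 2 * nsq (x - y).
  by rewrite ler_wpM2r ?nsq_ge0.
have h4 : (nsq x - nsq y) ^+ 2 * nsq y <= 4 * r * nsq (x - y) * r.
  by rewrite ler_pM ?sqr_ge0 ?nsq_ge0.
have -> : 10 * r ^+ 2 * nsq (x - y) =
  2 * (r ^+ 2 * nsq (x - y)) + 2 * (4 * r * nsq (x - y) * r) by ring.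
lra.
Qed.

Definition cfrom (a : R) (f df : R -> C) :=
  dfrom a (fun t => complex.Re (f t)) (fun t => complex.Re (df t)) /\
  dfrom a (fun t => complex.Im (f t)) (fun t => complex.Im (df t)).

Lemma cfrom_eq a f df dg : (forall t : R, a < t -> df t = dg t) ->
  cfrom a f df -> cfrom a f dg.
Proof.
by move=> e [fR fI]; split; [apply: dfrom_eq fR|apply: dfrom_eq fI] => t /e ->.
Qed.

Lemma cfromD a f df g dg : cfrom a f df -> cfrom a g dg ->
  cfrom a (fun t => f t + g t) (fun t => df t + dg t).
Proof.
move=> [zR zI] [wR wI]; split.
  by under [X in dfrom _ X]eq_fun do rewrite raddfD/=;
  under [X in dfrom _ _ X]eq_fun do rewrite raddfD/=; exact: dfromD.
by under [X in dfrom _ X]eq_fun do rewrite raddfD/=;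
under [X in dfrom _ _ X]eq_fun do rewrite raddfD/=; exact: dfromD.
Qed.

Lemma cfromB a f df g dg : cfrom a f df -> cfrom a g dg ->
  cfrom a (fun t => f t - g t) (fun t => df t - dg t).
Proof.
move=> [zR zI] [wR wI]; split.
  by under [X in dfrom _ X]eq_fun do rewrite raddfB/=;
  under [X in dfrom _ _ X]eq_fun do rewrite raddfB/=; exact: dfromB.
by under [X in dfrom _ X]eq_fun do rewrite raddfB/=;
under [X in dfrom _ _ X]eq_fun do rewrite raddfB/=; exact: dfromB.
Qed.

Lemma ReM z w : complex.Re (z * w) =
  complex.Re z * complex.Re w - complex.Im z * complex.Im w.
Proof. by case: z; case: w. Qed.

Lemma ImM z w : complex.Im (z * w) =
  complex.Re z * complex.Im w + complex.Im z * complex.Re w.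
Proof. by case: z; case: w. Qed.

Lemma cfromZ a c f df : cfrom a f df ->
  cfrom a (fun t => c * f t) (fun t => c * df t).
Proof.
move=> [zR zI]; split.
  under [X in dfrom _ X]eq_fun do rewrite ReM.
  under [X in dfrom _ _ X]eq_fun do rewrite ReM.
  by apply: dfromB; exact: dfromZ.
under [X in dfrom _ X]eq_fun do rewrite ImM.
under [X in dfrom _ _ X]eq_fun do rewrite ImM.
by apply: dfromD; exact: dfromZ.
Qed.

Lemma dfrom_nsq a f df : cfrom a f df ->
  dfrom a (fun t => nsq (f t)) (fun t => 2 * dotc (f t) (df t)).
Proof.
move=> [zR zI]; apply: dfrom_eq (dfromD (dfromX2 zR) (dfromX2 zI)) => t _.
by rewrite /dotc; ring.
Qed.

End ComplexCurves.

(** * Continuous phases of nonvanishing curves *)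

Section Phase.
Variable R : realType.
Local Notation C := R[i].

(** The imaginary part of the product of [w] with the conjugate of [z], whose real part is
    [dotc z w]; [crossc z dz / nsq z] is the angular velocity of a curve. *)
Definition crossc (z w : C) : R :=
  complex.Re z * complex.Im w - complex.Im z * complex.Re w.

Lemma nsqV (z : C) : nsq z^-1 = (nsq z)^-1.
Proof.
have [->|z0] := eqVneq z 0; first by rewrite invr0 nsq0 invr0.
apply: (mulfI (x := nsq z)); first by rewrite nsq_eq0.
rewrite -nsqM divff// divff ?nsq_eq0//.
by rewrite /nsq /= expr1n expr0n addr0.
Qed.

Lemma nsq_div (z w : C) : nsq (w / z) = nsq w / nsq z.
Proof. by rewrite nsqM nsqV. Qed.

Lemma Re_div (z w : C) : complex.Re (w / z) = dotc z w / nsq z.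
Proof.
have [->|z0] := eqVneq z 0; first by rewrite invr0 mulr0 nsq0 invr0 mulr0.
have n0 : nsq z != 0 by rewrite nsq_eq0.
by apply: (mulIf n0); rewrite divfK// -dotcMl divfK.
Qed.

Lemma Im_div (z w : C) : complex.Im (w / z) = crossc z w / nsq z.
Proof.
have [->|z0] := eqVneq z 0; first by rewrite invr0 mulr0 nsq0 invr0 mulr0.
have n0 : nsq z != 0 by rewrite nsq_eq0.
have crossMl (x : C) : crossc z (x * z) = complex.Im x * nsq z.
  by case: z {z0 n0} => a b; case: x => c d; rewrite /nsq /crossc/=; ring.
by apply: (mulIf n0); rewrite divfK// -crossMl divfK.
Qed.

Lemma dfrom_crossc (a : R) (z w dz dw : R -> C) : cfrom a z dz -> cfrom a w dw ->
  dfrom a (fun t => crossc (z t) (w t))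
    (fun t => crossc (dz t) (w t) + crossc (z t) (dw t)).
Proof.
move=> [zR zI] [wR wI].
apply: dfrom_eq (dfromB (dfromM zR wI) (dfromM zI wR)) => t _.
by rewrite /crossc; ring.
Qed.

(** The phase is an initial angle plus an antiderivative of the angular velocity. The latter is
    supplied as a continuous [f], since [cfrom] carries no continuity of [dz]. *)
Lemma phase_lift (z dz : R -> C) (f : R -> R) : cfrom 0 z dz ->
  (forall t, 0 <= t -> z t != 0) -> {within `[0, +oo[, continuous f} ->
  (forall t, 0 < t -> crossc (z t) (dz t) = f t * nsq (z t)) ->
  exists2 phi, is_phase z phi & dfrom 0 phi f.
Proof.
move=> Dz z0 cf fE; have [F F0 DF] := antiderivative cf.
have N0 t : 0 <= t -> 0 < nsq (z t) by move=> /z0; exact: nsq_gt0.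
pose r t := Num.sqrt (nsq (z t)).
have r0 t : 0 <= t -> 0 < r t by move=> /N0 ?; rewrite sqrtr_gt0.
have r2 t : r t ^+ 2 = nsq (z t) by rewrite sqr_sqrtr// nsq_ge0.
have [theta [ct st]] : exists theta, cos theta = complex.Re (z 0) / r 0 /\
    sin theta = complex.Im (z 0) / r 0.
  apply: cos_sin_surj; rewrite !expr_div_n -mulrDl -/(nsq (z 0)) r2 divff//.
  by rewrite gt_eqF// N0.
pose phi t := theta + F t.
have Dphi : dfrom 0 phi f.
  by apply: dfrom_eq (dfromD (dfrom_cst 0 theta) DF) => t _; rewrite add0r.
have [DR DI] := Dz.
have Dcos := @dfrom_comp R 0 cos (fun y => - sin y) phi f
  (fun t _ => is_derive_cos (phi t)) Dphi.
have Dsin := @dfrom_comp R 0 sin cos phi f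
  (fun t _ => is_derive_sin (phi t)) Dphi.
have Dr : dfrom 0 r (fun t => 2 * dotc (z t) (dz t) * (2 * r t)^-1).
  apply: (dfrom_comp (h := Num.sqrt) (dh := fun y => (2 * Num.sqrt y)^-1) _ (dfrom_nsq Dz)).
  by move=> t /N0 Nt; exact: is_derive1_sqrt.
have DV := dfromV (fun t t0 => lt0r_neq0 (r0 t t0)) Dr.
have DH := dfromD (dfromM Dcos DR) (dfromM Dsin DI).
(* The left side is the cosine of the angle between [z] and the direction [phi]: it equals 1 at time
   0 and its derivative vanishes. *)
have H1 t : 0 <= t -> (cos (phi t) * complex.Re (z t) + sin (phi t) * complex.Im (z t))
    / r t = 1.
  move=> t0; have := dfrom_eq0 (dfromM DH DV) _ t0; move=> /(_ _)/= ->.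
    rewrite /phi F0 addr0 ct st; have := r2 0; rewrite /nsq.
    have := r0 0 (lexx 0) => r00 E; apply: (mulIf (x := r 0 ^+ 2)).
      by rewrite expf_neq0// gt_eqF.
    by rewrite mul1r [in RHS]E; field; rewrite gt_eqF.
  move=> s s0; have rs := r0 s (ltW s0); have Ns := r2 s.
  have := fE s s0; rewrite /crossc -Ns => fs.
  have N0s := N0 s (ltW s0).
  move: Ns N0s fs; rewrite /nsq /dotc.
  move: (cos (phi s)) (sin (phi s)) (complex.Re (z s)) (complex.Im (z s)).
  move: (complex.Re (dz s)) (complex.Im (dz s)) (f s) rs; move: (r s).
  move=> q x' y' g q0 c n x y qE N0s gE.
  have q2 : q ^+ 2 != 0 by rewrite expf_neq0// gt_eqF.
  apply: (mulIf q2); apply: (mulIf q2); rewrite !mul0r.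
  transitivity (q * ((g * - n * x + c * x' + (g * c * y + n * y')) * q ^+ 2
    - (c * x + n * y) * (x * x' + y * y'))).
    by field; rewrite gt_eqF.
  apply/eqP; rewrite mulf_eq0; apply/orP; right; apply/eqP.
  have -> : (g * - n * x + c * x' + (g * c * y + n * y')) * q ^+ 2 =
    (- n * x + c * y) * (g * q ^+ 2) + (c * x' + n * y') * q ^+ 2 by ring.
  by rewrite -gE qE; ring.
exists phi => //; split; first by have [] := Dphi.
move=> t t0; split; first exact: z0.
have rt := r0 t t0; have := H1 t t0 => /(congr1 (fun x => x * r t)).
rewrite divfK ?gt_eqF// mul1r => E1; rewrite normc_nsq -/(r t).
have cs := cos2Dsin2 (phi t); have Nt := r2 t; rewrite /nsq in Nt.
move: cs Nt E1; case: (z t) => x y /=.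
move: (cos (phi t)) (sin (phi t)) => c n cs Nt E1.
(* Equality case of Cauchy-Schwarz: the component of [z] along the direction [phi] already has
   length [r t], so the orthogonal one is 0. *)
have E2 : (c * y - n * x) ^+ 2 = 0.
  have -> : (c * y - n * x) ^+ 2 = (c ^+ 2 + n ^+ 2) * (x ^+ 2 + y ^+ 2) -
    (c * x + n * y) ^+ 2 by ring.
  by rewrite cs -Nt E1; ring.
move/eqP: E2; rewrite sqrf_eq0 => /eqP E2.
have xE : x = r t * c.
  rewrite -E1 -[LHS]mul1r -cs; move/eqP: E2; rewrite subr_eq0 => /eqP E2.
  transitivity (c ^+ 2 * x + n * (n * x)); first by ring.
  by rewrite -E2; ring.
have yE : y = r t * n.
  rewrite -E1 -[LHS]mul1r -cs; move/eqP: E2; rewrite subr_eq0 => /eqP E2.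
  transitivity (c * (c * y) + n ^+ 2 * y); first by ring.
  by rewrite E2; ring.
by apply/eqP; rewrite eq_complex/= !mul0r subr0 addr0 -xE -yE !eqxx.
Qed.

End Phase.

(** * The energy, and the slow and fast coordinates of the system *)

Section StuartLandau.
Variable R : realType.
Local Notation C := R[i].
Variables alpha1 alpha2 omega1 omega2 kappa : R.
Hypotheses (halpha : alpha2 < alpha1) (halpha1 : alpha1 <= 0) (hkappa : 0 < kappa).
Implicit Types (t : R).

Let k := kappa / 2.
Let k0 : 0 < k. Proof. by rewrite divr_gt0. Qed.

Definition SL_curves (z1 z2 : R -> C) :=
  cfrom 0 z1 (fun t => SL_field alpha1 omega1 kappa (z1 t) (z2 t)) /\
  cfrom 0 z2 (fun t => SL_field alpha2 omega2 kappa (z2 t) (z1 t)).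

Lemma SL_curves_solution x0 (z1 z2 : R -> C) :
  SL_solution alpha1 alpha2 omega1 omega2 kappa x0 z1 z2 ->
  SL_curves z1 z2.
Proof.
move=> [[[c1 c2] [c3 c4]] _ _ D].
by split; split; split=> // t /D[[? ?] [? ?]].
Qed.

Lemma SL_fieldE (a o : R) (z w : C) : SL_field a o kappa z w =
  (a +i* o)%C * z - cubic z + k%:C%C * (w - z).
Proof. by rewrite /SL_field /cubic nsq_normc -/k; ring. Qed.

(** Since [alpha1] may be 0, the first oscillator is damped through the coupling:
    [nsq z <= 2 * nsq (z - w) + 2 * nsq w] leaves [2 * SL_rate] times [nsq (z - w)], absorbed by the
    coupling [k], and [3 * SL_rate] times [nsq w], absorbed by [- alpha2]. *)
Definition SL_rate : R := Num.min (k / 2) (- alpha2 / 3).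

Lemma SL_rate_gt0 : 0 < SL_rate.
Proof. by rewrite lt_min divr_gt0//= divr_gt0// oppr_gt0 (lt_le_trans halpha). Qed.

Lemma SL_energy_le (z w : C) :
  2 * dotc z (SL_field alpha1 omega1 kappa z w) +
  2 * dotc w (SL_field alpha2 omega2 kappa w z) <=
  - (2 * SL_rate) * (nsq z + nsq w).
Proof.
have -> : 2 * dotc z (SL_field alpha1 omega1 kappa z w) +
    2 * dotc w (SL_field alpha2 omega2 kappa w z) =
    2 * (alpha1 * nsq z + alpha2 * nsq w - nsq z ^+ 2 - nsq w ^+ 2
         - k * nsq (z - w)).
  rewrite !SL_fieldE; case: z => a b; case: w => c d.
  by rewrite /cubic /nsq /dotc/=; ring.
have l1 : SL_rate <= k / 2 by rewrite ge_min lexx.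
have l2 : SL_rate <= - alpha2 / 3 by rewrite ge_min lexx orbT.
have zw : nsq z <= 2 * nsq (z - w) + 2 * nsq w.
  by rewrite -[X in nsq X <= _](subrK w); exact: nsqD_le.
have l0 := SL_rate_gt0.
have h1 : SL_rate * nsq z <= SL_rate * (2 * nsq (z - w) + 2 * nsq w).
  by rewrite ler_pM2l.
have h2 : SL_rate * (2 * nsq (z - w)) <= k / 2 * (2 * nsq (z - w)).
  by rewrite ler_wpM2r// mulr_ge0 ?nsq_ge0.
have h3 : SL_rate * (3 * nsq w) <= - alpha2 / 3 * (3 * nsq w).
  by rewrite ler_wpM2r// mulr_ge0 ?nsq_ge0.
have h4 : alpha1 * nsq z <= 0 by rewrite mulr_le0_ge0 ?nsq_ge0.
have h5 := (sqr_ge0 (nsq z), sqr_ge0 (nsq w)); case: h5 => /= h5 h6.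
have e3 : - alpha2 / 3 * (3 * nsq w) = - (alpha2 * nsq w) by field.
have e2 : k / 2 * (2 * nsq (z - w)) = k * nsq (z - w) by field.
rewrite e3 in h3; rewrite e2 in h2.
lra.
Qed.

Lemma SL_energy_decay z1 z2 : SL_curves z1 z2 -> forall t, 0 <= t ->
  nsq (z1 t) + nsq (z2 t) <=
  (nsq (z1 0) + nsq (z2 0)) * expR (- (2 * SL_rate) * t).
Proof.
move=> [D1 D2] t t0; have D := dfromD (dfrom_nsq D1) (dfrom_nsq D2).
have := dfrom_expR_le D _ (lexx 0) t0; rewrite subr0; apply => s _.
exact: SL_energy_le.
Qed.

Lemma SL_energy_le0 z1 z2 : SL_curves z1 z2 -> forall t, 0 <= t ->
  nsq (z1 t) + nsq (z2 t) <= nsq (z1 0) + nsq (z2 0).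
Proof.
move=> S t t0; rewrite (le_trans (SL_energy_decay S t0))// ler_piMr//.
  by rewrite addr_ge0 ?nsq_ge0.
by rewrite -expR0 ler_expR mulNr oppr_le0 !mulr_ge0// ltW// SL_rate_gt0.
Qed.

Lemma SL_curves0 : SL_curves (fun=> 0) (fun=> 0).
Proof.
have H a o : cfrom 0 (fun=> 0 : C) (fun=> SL_field a o kappa 0 0).
  apply: (@cfrom_eq _ _ _ (fun=> 0)) => [t _|].
    by rewrite SL_fieldE /cubic subr0 !mulr0 subr0 addr0.
  by split; exact: dfrom_cst.
by split.
Qed.

(* The linear part is conjugate to diag (lambda + mu, lambda - mu), where
   mu ^+ 2 = delta ^+ 2 + k ^+ 2; slow and fast are the coordinates along its
   eigenvectors, and e stands for mu - delta. *)
Let m : R := (alpha1 + alpha2) / 2 - k.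
Let delta : C := ((alpha1 - alpha2) / 2 +i* ((omega1 - omega2) / 2))%C.
Let lambda : C := (m +i* ((omega1 + omega2) / 2))%C.
Variable e : C.
Hypothesis eE : k%:C%C * k%:C%C = e * (e + 2 * delta).
Let mu := e + delta.
Let rho := complex.Re mu.
Hypothesis rho_gt0 : 0 < rho.

Definition slow (z w : C) : C := k%:C%C * z + e * w.
Definition fast (z w : C) : C := k%:C%C * w - e * z.

Let nsq_det_gt0 : 0 < nsq (2 * e * mu).
Proof.
rewrite nsq_gt0// !mulf_neq0//.
- apply/eqP => e0; move/eqP: eE; rewrite e0 mul0r mulf_eq0 orbb.
  by rewrite eq_complex/= gt_eqF.
- by apply/eqP => mu0; move: rho_gt0; rewrite /rho mu0 ltxx.
Qed.

(** Cramer's rule: the change of coordinates has determinant [k ^+ 2 + e ^+ 2], which is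
    [2 * e * mu] by [eE]. *)
Lemma slow_fastKl (z w : C) : (2 * e * mu) * z = k%:C%C * slow z w - e * fast z w.
Proof.
rewrite /slow /fast; transitivity ((k%:C%C * k%:C%C + e * e) * z); last by ring.
by rewrite eE /mu; ring.
Qed.

Lemma slow_fastKr (z w : C) : (2 * e * mu) * w = e * slow z w + k%:C%C * fast z w.
Proof.
rewrite /slow /fast; transitivity ((k%:C%C * k%:C%C + e * e) * w); last by ring.
by rewrite eE /mu; ring.
Qed.

Let cst1 : R := 2 * (k ^+ 2 + nsq e).
Let cst0 : R := cst1 / nsq (2 * e * mu).

Let cst1_ge0 : 0 <= cst1.
Proof. by rewrite mulr_ge0// addr_ge0 ?sqr_ge0 ?nsq_ge0. Qed.
Let cst0_ge0 : 0 <= cst0.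
Proof. by rewrite divr_ge0// nsq_ge0. Qed.

Lemma slow_fast_le (z w : C) :
  nsq (slow z w) + nsq (fast z w) <= cst1 * (nsq z + nsq w).
Proof.
rewrite /slow /fast (le_trans (lerD (nsqD_le _ _) (nsqB_le _ _)))//.
by rewrite !nsqM nsq_real /cst1; lra.
Qed.

Lemma slow_fast_ge (z w : C) :
  nsq z + nsq w <= cst0 * (nsq (slow z w) + nsq (fast z w)).
Proof.
rewrite /cst0 mulrAC ler_pdivlMr// mulrC mulrDr -!nsqM.
rewrite (slow_fastKl z w) (slow_fastKr z w).
rewrite (le_trans (lerD (nsqB_le _ _) (nsqD_le _ _)))//.
by rewrite !nsqM nsq_real /cst1; lra.
Qed.

(** With [q = 10 * cst1 * cst0], the squared nonlinear part in the new coordinates is Lipschitz with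
    constant [q * r ^+ 2]. The 1 replaces a square root, as [q <= (q + 1) ^+ 2], and the 2 comes
    from differentiating a square. *)
Definition SL_pert : R := 2 * (10 * cst1 * cst0 + 1).

Lemma SL_pert_gt0 : 0 < SL_pert.
Proof. by rewrite mulr_gt0// ltr_wpDl// mulr_ge0// mulr_ge0. Qed.

(** The linear part is a symmetric, not Hermitian, matrix. Its eigenvectors are thus also left
    eigenvectors, and the coordinates are bilinear pairings without conjugates. *)
Let slow_field (z w : C) : slow (SL_field alpha1 omega1 kappa z w)
    (SL_field alpha2 omega2 kappa w z) =
  (lambda + mu) * slow z w - slow (cubic z) (cubic w).
Proof.
rewrite !SL_fieldE /slow.
have -> : (alpha1 +i* omega1)%C = lambda + delta + k%:C%C.
  by apply/eqP; rewrite eq_complex/= /m -/k; apply/andP; split; apply/eqP; field.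
have -> : (alpha2 +i* omega2)%C = lambda - delta + k%:C%C.
  by apply/eqP; rewrite eq_complex/= /m -/k; apply/andP; split; apply/eqP; field.
have eE' := eE; set K := k%:C%C in eE' *; rewrite /mu.
transitivity (K * (lambda + (e + delta)) * z + (K * K + e * (lambda - delta)) * w
  - (K * cubic z + e * cubic w)); first by ring.
by rewrite eE'; ring.
Qed.

Let fast_field (z w : C) : fast (SL_field alpha1 omega1 kappa z w)
    (SL_field alpha2 omega2 kappa w z) =
  (lambda - mu) * fast z w - fast (cubic z) (cubic w).
Proof.
rewrite !SL_fieldE /fast.
have -> : (alpha1 +i* omega1)%C = lambda + delta + k%:C%C.
  by apply/eqP; rewrite eq_complex/= /m -/k; apply/andP; split; apply/eqP; field.
have -> : (alpha2 +i* omega2)%C = lambda - delta + k%:C%C.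
  by apply/eqP; rewrite eq_complex/= /m -/k; apply/andP; split; apply/eqP; field.
have eE' := eE; set K := k%:C%C in eE' *; rewrite /mu.
transitivity (K * (lambda - (e + delta)) * w + (K * K - e * (lambda + delta)) * z
  - (K * cubic w - e * cubic z)); first by ring.
by rewrite eE'; ring.
Qed.

(** * Growth of the difference of two solutions *)

Definition slow_dist (z1 z2 y1 y2 : R -> C) t := nsq (slow (z1 t - y1 t) (z2 t - y2 t)).
Definition fast_dist (z1 z2 y1 y2 : R -> C) t := nsq (fast (z1 t - y1 t) (z2 t - y2 t)).

Section Difference.
Variables z1 z2 y1 y2 : R -> C.
Hypotheses (Sz : SL_curves z1 z2) (Sy : SL_curves y1 y2).

Let U t := slow (z1 t - y1 t) (z2 t - y2 t).
Let V t := fast (z1 t - y1 t) (z2 t - y2 t).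
Let NU t := slow (cubic (z1 t) - cubic (y1 t)) (cubic (z2 t) - cubic (y2 t)).
Let NV t := fast (cubic (z1 t) - cubic (y1 t)) (cubic (z2 t) - cubic (y2 t)).

Let DU : cfrom 0 U (fun t => (lambda + mu) * U t - NU t).
Proof.
have [D1 D2] := Sz; have [E1 E2] := Sy.
have := cfromD (cfromZ k%:C%C (cfromB D1 E1)) (cfromZ e (cfromB D2 E2)).
apply: cfrom_eq => t _.
rewrite /U /NU; have := slow_field (z1 t) (z2 t); have := slow_field (y1 t) (y2 t).
rewrite /slow; move=> h1 h2.
transitivity ((k%:C%C * SL_field alpha1 omega1 kappa (z1 t) (z2 t) +
  e * SL_field alpha2 omega2 kappa (z2 t) (z1 t)) -
  (k%:C%C * SL_field alpha1 omega1 kappa (y1 t) (y2 t) +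
  e * SL_field alpha2 omega2 kappa (y2 t) (y1 t))); first by ring.
by rewrite h1 h2; ring.
Qed.

Let DV : cfrom 0 V (fun t => (lambda - mu) * V t - NV t).
Proof.
have [D1 D2] := Sz; have [E1 E2] := Sy.
have := cfromB (cfromZ k%:C%C (cfromB D2 E2)) (cfromZ e (cfromB D1 E1)).
apply: cfrom_eq => t _.
rewrite /V /NV; have := fast_field (z1 t) (z2 t); have := fast_field (y1 t) (y2 t).
rewrite /fast; move=> h1 h2.
transitivity ((k%:C%C * SL_field alpha2 omega2 kappa (z2 t) (z1 t) -
  e * SL_field alpha1 omega1 kappa (z1 t) (z2 t)) -
  (k%:C%C * SL_field alpha2 omega2 kappa (y2 t) (y1 t) -
  e * SL_field alpha1 omega1 kappa (y1 t) (y2 t))); first by ring.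
by rewrite h1 h2; ring.
Qed.

Let small (r t : R) := [/\ 0 <= r, nsq (z1 t) <= r, nsq (z2 t) <= r,
  nsq (y1 t) <= r & nsq (y2 t) <= r].

Let pert_le r t : small r t -> nsq (NU t) + nsq (NV t) <=
  (SL_pert / 2 * r) ^+ 2 * (nsq (U t) + nsq (V t)).
Proof.
move=> [r0 a1 a2 b1 b2]; rewrite (le_trans (slow_fast_le _ _))//.
have := lerD (cubic_lipschitz a1 b1) (cubic_lipschitz a2 b2); rewrite -mulrDr.
set D := nsq _ + nsq (z2 t - y2 t) => H.
have DUV : D <= cst0 * (nsq (U t) + nsq (V t)) by exact: slow_fast_ge.
rewrite (le_trans (ler_wpM2l cst1_ge0 H))//.
set S := nsq _ + nsq (V t) in DUV *.
have S0 : 0 <= S by rewrite addr_ge0 ?nsq_ge0.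
have -> : SL_pert / 2 = 10 * cst1 * cst0 + 1 by rewrite /SL_pert; field.
set q := 10 * cst1 * cst0.
have q0 : 0 <= q by rewrite mulr_ge0// mulr_ge0.
have h1 : cst1 * (10 * r ^+ 2 * D) <= q * r ^+ 2 * S.
  have -> : q * r ^+ 2 * S = cst1 * (10 * r ^+ 2 * (cst0 * S)) by rewrite /q; ring.
  by rewrite ler_wpM2l// ler_wpM2l// mulr_ge0// sqr_ge0.
rewrite (le_trans h1)// ler_wpM2r// exprMn ler_wpM2r ?sqr_ge0//; nra.
Qed.

(** The eigenvalues have real parts [m + rho] and [m - rho]; the difference of the cubic terms only
    perturbs these rates by a multiple of [r]. The bound [r] may depend on [t], so energy decay can
    be inserted later. *)
Lemma SL_difference : exists a b : R -> R,
  [/\ dfrom 0 (slow_dist z1 z2 y1 y2) a, dfrom 0 (fast_dist z1 z2 y1 y2) b &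
   forall t r, 0 < t -> nsq (z1 t) <= r -> nsq (z2 t) <= r ->
     nsq (y1 t) <= r -> nsq (y2 t) <= r ->
     let A := slow_dist z1 z2 y1 y2 t in let B := fast_dist z1 z2 y1 y2 t in
    `|a t - 2 * (m + rho) * A| <= SL_pert * r * (A + B) /\
    `|b t - 2 * (m - rho) * B| <= SL_pert * r * (A + B)].
Proof.
have := dfrom_nsq DU; have := dfrom_nsq DV.
move=> Db Da; do 2 eexists; split; [exact: Da|exact: Db|].
move=> t r t0 z1r z2r y1r y2r A B; rewrite {}/A {}/B /slow_dist /fast_dist.
rewrite -/(U t) -/(V t).
have sr : small r t by split=> //; exact: le_trans (nsq_ge0 _) z1r.
have := pert_le sr; have [r0 _ _ _ _] := sr.
have Rp : complex.Re (lambda + mu) = m + rho.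
  by rewrite /rho; case: mu.
have Rm : complex.Re (lambda - mu) = m - rho.
  by rewrite /rho; case: mu.
rewrite (dotcB _ _ (NU t)) (dotcB _ _ (NV t)) !dotcMl Rp Rm.
have := (nsq_ge0 (NU t), nsq_ge0 (NV t)); case=> /= nu nv.
have := (nsq_ge0 (U t), nsq_ge0 (V t)); case=> /= u0 v0.
set S := nsq (U t) + nsq (V t) => H.
have S0 : 0 <= S by rewrite addr_ge0.
have p0 : 0 <= SL_pert / 2 * r * S.
  by rewrite mulr_ge0// mulr_ge0// divr_ge0// ltW// SL_pert_gt0.
have K (x y : C) : nsq x <= S -> nsq y <= (SL_pert / 2 * r) ^+ 2 * S ->
    `|dotc x y| <= SL_pert / 2 * r * S.
  move=> xS yS; apply: dotc_le => //.
  rewrite [leRHS](_ : _ = S * ((SL_pert / 2 * r) ^+ 2 * S)); last by ring.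
  by rewrite ler_pM ?nsq_ge0.
have h1 : `|dotc (U t) (NU t)| <= SL_pert / 2 * r * S.
  by apply: K; [rewrite lerDl|lra].
have h2 : `|dotc (V t) (NV t)| <= SL_pert / 2 * r * S.
  by apply: K; [rewrite lerDr|lra].
have two (c d n : R) : `|2 * (c * n - d) - 2 * c * n| = 2 * `|d|.
  have -> : 2 * (c * n - d) - 2 * c * n = - (2 * d) by ring.
  by rewrite normrN normrM ger0_norm.
by rewrite !two; split; lra.
Qed.

End Difference.

Definition curve_dist (z1 z2 y1 y2 : R -> C) t := nsq (z1 t - y1 t) + nsq (z2 t - y2 t).

Lemma SL_nsq_le r (z1 z2 : R -> C) : SL_curves z1 z2 ->
  nsq (z1 0) + nsq (z2 0) <= r -> forall t, 0 <= t ->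
  nsq (z1 t) <= r /\ nsq (z2 t) <= r.
Proof.
move=> S Er t t0; have := SL_energy_le0 S t0.
by have := (nsq_ge0 (z1 t), nsq_ge0 (z2 t)); case=> /= ? ?; split; lra.
Qed.

(** Grönwall from below for [slow_dist + fast_dist]: as energy never exceeds its initial value, the
    logarithmic derivative is bounded below by [- c] uniformly. Thus a state at a bounded time
    determines the datum in a Lipschitz way. *)
Lemma SL_backward (r T : R) : 0 <= T -> exists L : R, 0 <= L /\
  forall z1 z2 y1 y2 : R -> C, SL_curves z1 z2 -> SL_curves y1 y2 ->
  nsq (z1 0) + nsq (z2 0) <= r -> nsq (y1 0) + nsq (y2 0) <= r ->
  forall t, 0 <= t -> t <= T ->
  curve_dist z1 z2 y1 y2 0 <= L * curve_dist z1 z2 y1 y2 t.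
Proof.
move=> T0; pose c := 2 * `|m + rho| + 2 * `|m - rho| + 2 * (SL_pert * `|r|).
have c0 : 0 <= c.
  by rewrite !addr_ge0// mulr_ge0// mulr_ge0// ltW// SL_pert_gt0.
exists (cst0 * (expR (c * T) * cst1)); split.
  by rewrite mulr_ge0// mulr_ge0// expR_ge0.
move=> z1 z2 y1 y2 Sz Sy Ez Ey t t0 tT.
have [a [b [Da Db ab]]] := SL_difference Sz Sy.
have H s : 0 < s -> - c * (slow_dist z1 z2 y1 y2 s + fast_dist z1 z2 y1 y2 s) <= a s + b s.
  move=> s0; have [z1r z2r] := SL_nsq_le Sz Ez (ltW s0).
  have [y1r y2r] := SL_nsq_le Sy Ey (ltW s0).
  have rr := ler_norm r.
  have [] := ab s `|r| s0 (le_trans z1r rr) (le_trans z2r rr)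
    (le_trans y1r rr) (le_trans y2r rr).
  have : 0 <= slow_dist z1 z2 y1 y2 s by exact: nsq_ge0.
  have : 0 <= fast_dist z1 z2 y1 y2 s by exact: nsq_ge0.
  move: (slow_dist _ _ _ _ s) (fast_dist _ _ _ _ s) => A B B0 A0.
  have h1 : - `|m + rho| * A <= (m + rho) * A.
    by rewrite ler_wpM2r// lerNl -normrN ler_norm.
  have h2 : - `|m - rho| * B <= (m - rho) * B.
    by rewrite ler_wpM2r// lerNl -normrN ler_norm.
  have h3 : 0 <= `|m + rho| * B by rewrite mulr_ge0.
  have h4 : 0 <= `|m - rho| * A by rewrite mulr_ge0.
  rewrite !ler_norml /c; move: (SL_pert * `|r|) => p; lra.
have := dfrom_expR_ge (dfromD Da Db) H (lexx 0) t0; rewrite subr0 mulNr expRN.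
rewrite ler_pdivrMr ?expR_gt0// => H1.
rewrite (le_trans (slow_fast_ge _ _))// -mulrA -/cst0 ler_wpM2l//.
rewrite (le_trans H1)// [leLHS]mulrC -mulrA ler_pM ?expR_ge0//.
  by apply: addr_ge0; exact: nsq_ge0.
  by rewrite ler_expR ler_wpM2l.
exact: slow_fast_le.
Qed.

(** Needed to compare orbits that hit zero at different times. *)
Lemma SL_speed (r : R) : exists V : R, 0 <= V /\
  forall z1 z2 : R -> C, SL_curves z1 z2 -> nsq (z1 0) + nsq (z2 0) <= r ->
  forall s t, 0 <= s -> s <= t ->
  nsq (z1 t - z1 s) <= V * (t - s) ^+ 2 /\ nsq (z2 t - z2 s) <= V * (t - s) ^+ 2.
Proof.
have field_le a o : exists2 W, 0 <= W & forall z w : C, nsq z <= r -> nsq w <= r ->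
    nsq (SL_field a o kappa z w) <= W.
  exists (4 * nsq (a +i* o)%C * `|r| + 4 * (r ^+ 2 * `|r|) + 8 * k ^+ 2 * `|r|).
    have p1 := mulr_ge0 (nsq_ge0 (a +i* o)%C) (normr_ge0 r).
    have p2 := mulr_ge0 (sqr_ge0 r) (normr_ge0 r).
    have p3 := mulr_ge0 (sqr_ge0 k) (normr_ge0 r).
    lra.
  move=> z w zr wr; have r0 : 0 <= r := le_trans (nsq_ge0 z) zr.
  rewrite SL_fieldE ger0_norm// -/k.
  rewrite (le_trans (nsqD_le _ _))// !nsqM nsq_real.
  have h1 := nsqB_le ((a +i* o)%C * z) (cubic z).
  rewrite /cubic !nsqM nsq_real in h1.
  have h2 : nsq z ^+ 2 * nsq z <= r ^+ 2 * r.
    by rewrite ler_pM ?sqr_ge0 ?nsq_ge0// lerXn2r ?nnegrE ?nsq_ge0.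
  have h3 : nsq (a +i* o)%C * nsq z <= nsq (a +i* o)%C * r.
    by rewrite ler_wpM2l ?nsq_ge0.
  have h4 : k ^+ 2 * nsq (w - z) <= k ^+ 2 * (4 * r).
    rewrite ler_wpM2l ?sqr_ge0// (le_trans (nsqB_le _ _))//; lra.
  rewrite /cubic; lra.
have [W1 W10 F1] := field_le alpha1 omega1.
have [W2 W20 F2] := field_le alpha2 omega2.
(* The added 1 turns a bound on squared speed into one on speed, by [x <= (x + 1) ^+ 2]. *)
pose W := W1 + W2 + 1.
have comp s t f df : 0 <= s -> s <= t -> dfrom 0 f df ->
    (forall x, 0 < x -> df x ^+ 2 <= W1 + W2) -> (f t - f s) ^+ 2 <= W ^+ 2 * (t - s) ^+ 2.
  move=> s0 st Df fW.
  have Dg : dfrom s (fun x : R => W * x) (fun=> W).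
    apply: dfrom_eq (dfromZ W (dfrom_derive _ (fun t => is_derive_id t (1 : R)))).
    by move=> ? _; rewrite mulr1.
  have := dfrom_norm_le (dfromW s0 Df) Dg _ st; rewrite -mulrBr => H.
  rewrite -exprMn -[_ ^+ 2]real_normK ?num_real// lerXn2r ?nnegrE//.
    by rewrite mulr_ge0 ?subr_ge0// !addr_ge0.
  apply: H => x sx; have := fW x (le_lt_trans s0 sx) => h.
  rewrite -(@ler_pXn2r _ 2)// ?nnegrE ?addr_ge0// real_normK ?num_real//.
  by rewrite (le_trans h)// /W; nra.
exists (2 * W ^+ 2); split; first by rewrite mulr_ge0// sqr_ge0.
move=> z1 z2 [[D1 D2] [D3 D4]] E s t s0 st.
have S : SL_curves z1 z2 by [].
have comp2 f g df dg : dfrom 0 f df -> dfrom 0 g dg ->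
    (forall x, 0 < x -> df x ^+ 2 + dg x ^+ 2 <= W1 + W2) ->
    (f t - f s) ^+ 2 + (g t - g s) ^+ 2 <= 2 * W ^+ 2 * (t - s) ^+ 2.
  move=> Df Dg H.
  have h1 : (f t - f s) ^+ 2 <= W ^+ 2 * (t - s) ^+ 2.
    by apply: (comp _ _ _ _ s0 st Df) => x /H; have := sqr_ge0 (dg x); lra.
  have h2 : (g t - g s) ^+ 2 <= W ^+ 2 * (t - s) ^+ 2.
    by apply: (comp _ _ _ _ s0 st Dg) => x /H; have := sqr_ge0 (df x); lra.
  lra.
split.
  rewrite /nsq !raddfB/=; apply: (comp2 _ _ _ _ D1 D2) => x x0.
  have [h1 h2] := SL_nsq_le S E (ltW x0).
  by have := F1 _ _ h1 h2; rewrite /nsq; lra.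
rewrite /nsq !raddfB/=; apply: (comp2 _ _ _ _ D3 D4) => x x0.
have [h1 h2] := SL_nsq_le S E (ltW x0).
by have := F2 _ _ h2 h1; rewrite /nsq; lra.
Qed.

(* The time T is an argument of Q because two solutions may be compared at
   different times. *)
Lemma SL_negligible (Q : (R -> C) -> (R -> C) -> R -> R * R * R -> Prop)
    (r M : R) (N : nat) : 0 <= M ->
  (forall z1 z2 T p, SL_curves z1 z2 -> nsq (z1 0) + nsq (z2 0) <= r ->
    Q z1 z2 T p -> 0 <= T <= N%:R /\
    [/\ `|p.1.1| <= N%:R, `|p.1.2| <= N%:R & `|p.2| <= N%:R]) ->
  (forall z1 z2 T p y1 y2 S q G, 0 <= G ->
    SL_curves z1 z2 -> nsq (z1 0) + nsq (z2 0) <= r -> Q z1 z2 T p ->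
    SL_curves y1 y2 -> nsq (y1 0) + nsq (y2 0) <= r -> Q y1 y2 S q ->
    `|p.1.1 - q.1.1| <= G -> `|p.1.2 - q.1.2| <= G -> `|p.2 - q.2| <= G ->
    `|T - S| <= G /\
    nsq (z1 T - y1 S) + nsq (z2 T - y2 S) <= M * G ^+ 2) ->
  (@lebesgue4 R).-negligible [set x0 | exists z1 z2 T p,
    [/\ SL_solution alpha1 alpha2 omega1 omega2 kappa x0 z1 z2,
        nsq (z1 0) + nsq (z2 0) <= r & Q z1 z2 T p]].
Proof.
move=> M0 Qb Qd.
have [L [L0 HL]] := @SL_backward r N%:R (ler0n _ N).
have [V [V0 HV]] := SL_speed r.
pose P x0 p := exists z1 z2 T,
    [/\ SL_solution alpha1 alpha2 omega1 omega2 kappa x0 z1 z2,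
        nsq (z1 0) + nsq (z2 0) <= r & Q z1 z2 T p].
suff : (@lebesgue4 R).-negligible [set x0 | exists p, P x0 p].
  apply: negligibleS => x0 [z1 [z2 [T [p [S E q]]]]].
  by exists p, z1, z2, T.
apply: (@negligible_lipschitz_param R P N (L * (2 * M + 4 * V))).
  move=> x p [z1 [z2 [T [S E q]]]].
  by have [] := Qb _ _ _ _ (SL_curves_solution S) E q.
move=> x p y q G G0 [z1 [z2 [T [Sz Ez Qz]]]] [y1 [y2 [S [Sy Ey Qy]]]].
have dE : sqdist x y = curve_dist z1 z2 y1 y2 0.
  have [_ z10 z20 _] := Sz; have [_ y10 y20 _] := Sy.
  by rewrite /sqdist /curve_dist z10 z20 y10 y20 /nsq/=.
move=> g1 g2 g3.
have Cz := SL_curves_solution Sz; have Cy := SL_curves_solution Sy.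
have [/andP[T0 TN] _] := Qb _ _ _ _ Cz Ez Qz.
have [/andP[S0 SN] _] := Qb _ _ _ _ Cy Ey Qy.
have [TS H] := Qd _ _ _ _ _ _ _ _ _ G0 Cz Ez Qz Cy Ey Qy g1 g2 g3.
have TS2 : (T - S) ^+ 2 <= G ^+ 2.
  by rewrite -[_ ^+ 2]real_normK ?num_real// lerXn2r ?nnegrE.
have VTS : V * (T - S) ^+ 2 <= V * G ^+ 2 by rewrite ler_wpM2l.
rewrite dE -mulrA.
have step (a b c : C) : nsq (a - c) <= 2 * nsq (a - b) + 2 * nsq (b - c).
  have -> : a - c = (a - b) + (b - c) by ring.
  exact: nsqD_le.
(* Both solutions are compared at the earlier time. Carrying the later state back costs [2 * V] per
   oscillator, hence [4 * V]; [2 * M] comes from the states at [T] and [S]. *)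
have [le|/ltW le] := leP T S.
  rewrite (le_trans (HL _ _ _ _ Cz Cy Ez Ey T T0 TN))// ler_wpM2l//.
  have [h1 h2] := HV _ _ Cy Ey _ _ T0 le.
  have := step (z1 T) (y1 S) (y1 T); have := step (z2 T) (y2 S) (y2 T).
  have e1 : (S - T) ^+ 2 = (T - S) ^+ 2 by ring.
  by rewrite /curve_dist; rewrite e1 in h1 h2; lra.
rewrite (le_trans (HL _ _ _ _ Cz Cy Ez Ey S S0 SN))// ler_wpM2l//.
have [h1 h2] := HV _ _ Cz Ez _ _ S0 le.
have := step (z1 S) (z1 T) (y1 S); have := step (z2 S) (z2 T) (y2 S).
rewrite /curve_dist -(nsqN (z1 S - z1 T)) -(nsqN (z2 S - z2 T)) !opprB.
lra.
Qed.

Lemma hits_zero_negligible (N : nat) :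
  (@lebesgue4 R).-negligible [set x0 | exists z1 z2,
    [/\ SL_solution alpha1 alpha2 omega1 omega2 kappa x0 z1 z2,
        nsq (z1 0) + nsq (z2 0) <= N%:R &
        exists2 T, 0 <= T <= N%:R & z1 T = 0 \/ z2 T = 0]].
Proof.
have sq_le (x : R) : x ^+ 2 <= N%:R -> `|x| <= N%:R.
  move=> h; rewrite -(@ler_pXn2r _ 2)// ?nnegrE// real_normK ?num_real//.
  by rewrite (le_trans h)// -natrX ler_nat; case: (N) => // n; rewrite leq_pmull.
pose Q (j : bool) (z1 z2 : R -> C) T (p : R * R * R) :=
  [/\ 0 <= T <= N%:R, (if j then z1 T else z2 T) = 0 &
      let w := if j then z2 T else z1 T in p = (complex.Re w, complex.Im w, T)].
have HQ j : (@lebesgue4 R).-negligible [set x0 | exists z1 z2 T p,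
    [/\ SL_solution alpha1 alpha2 omega1 omega2 kappa x0 z1 z2,
        nsq (z1 0) + nsq (z2 0) <= N%:R & Q j z1 z2 T p]].
  (* [M = 2]: the vanishing oscillator contributes nothing, and the two real coordinates of the
     other one are each within [G]. *)
  apply: (@SL_negligible (Q j) N%:R 2 N) => //.
    move=> z1 z2 T p Cz Ez [TN _ ->]/=; split=> //.
    have [/andP[T0 TN'] [n1 n2]] := (TN, SL_nsq_le Cz Ez (proj1 (andP TN))).
    rewrite (ger0_norm T0); have wn : nsq (if j then z2 T else z1 T) <= N%:R by case: (j).
    split=> //; apply: sq_le; move: wn; rewrite /nsq.
      have := sqr_ge0 (complex.Im (if j then z2 T else z1 T)); lra.
    have := sqr_ge0 (complex.Re (if j then z2 T else z1 T)); lra.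
  move=> z1 z2 T p y1 y2 S q G G0 Cz Ez [TN z0 ->] Cy Ey [SN y0 ->]/= g1 g2 g3.
  split=> //.
  have sqG (x : R) : `|x| <= G -> x ^+ 2 <= G ^+ 2.
    by move=> h; rewrite -[_ ^+ 2]real_normK ?num_real// lerXn2r ?nnegrE.
  have := sqG _ g1; have := sqG _ g2; rewrite -!raddfB/=.
  move: z0 y0; case: (j) => -> ->; rewrite subrr nsq0 /nsq/=; lra.
apply: negligibleS (negligibleU (HQ true) (HQ false)).
move=> x0 [z1 [z2 [S E [T TN [z0|z0]]]]]; [left|right]; exists z1, z2, T.
  by exists (complex.Re (z2 T), complex.Im (z2 T), T).
by exists (complex.Re (z1 T), complex.Im (z1 T), T).
Qed.

(** * The dichotomy between slow and fast coordinates *)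

Lemma expR_small (c eps : R) : 0 < c -> 0 < eps ->
  exists n : nat, forall t, n%:R <= t -> expR (- c * t) <= eps.
Proof.
move=> c0 e0; pose n := (Num.truncn (1 / (c * eps))).+1.
have nE : 1 / (c * eps) < n%:R by exact: truncnS_gt.
exists n => t nt; rewrite mulNr expRN -[leRHS]invrK lef_pV2 ?posrE ?expR_gt0 ?invr_gt0//.
rewrite (le_trans _ (expR_ge1Dx _))// ler_wpDl//.
move: nE; rewrite ltr_pdivrMr ?mulr_gt0// => nE.
rewrite -(ler_pM2r e0) mulVf ?gt_eqF//.
have : c * eps * n%:R <= c * eps * t by rewrite ler_wpM2l// ltW// mulr_gt0.
lra.
Qed.

(** Past time [n] the cubic term contributes at most [rho / 2 * (A + B)] to each derivative. So
    [A - B] has derivative at least [(2 * m + rho) * A - (2 * m - rho) * B], hence at least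
    [(2 * m + rho) * (A - B)]: the cone [B < A] is forward invariant. While [A <= B], the rate of
    [B] is at most [2 * m - rho]. The time [n] depends on [r] but not on the solutions. *)
Lemma SL_cone (r : R) : exists n : nat, forall z1 z2 y1 y2 : R -> C,
  SL_curves z1 z2 -> SL_curves y1 y2 ->
  nsq (z1 0) + nsq (z2 0) <= r -> nsq (y1 0) + nsq (y2 0) <= r ->
  let A := slow_dist z1 z2 y1 y2 in let B := fast_dist z1 z2 y1 y2 in
  (forall s t, n%:R <= s -> s <= t ->
    (A s - B s) * expR ((2 * m + rho) * (t - s)) <= A t - B t) /\
  ((forall t, n%:R <= t -> A t <= B t) -> forall t, n%:R <= t ->
    B t <= B n%:R * expR ((2 * m - rho) * (t - n%:R))).
Proof.
have l0 : 0 < 2 * SL_rate by rewrite mulr_gt0// SL_rate_gt0.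
have P0 := SL_pert_gt0.
have Pr0 : 0 < SL_pert * (`|r| + 1) by apply: mulr_gt0 => //; rewrite ltr_wpDl.
have [n nP] := expR_small l0 (divr_gt0 (divr_gt0 rho_gt0 (ltr0Sn _ 1)) Pr0).
exists n => z1 z2 y1 y2 Sz Sy Ez Ey A B.
have [a [b [Da Db ab]]] := SL_difference Sz Sy.
have n0 : 0 <= n%:R :> R by [].
have r0 : 0 <= r by rewrite (le_trans _ Ez)// addr_ge0// nsq_ge0.
have A0 t : 0 <= A t by exact: nsq_ge0.
have B0 t : 0 <= B t by exact: nsq_ge0.
have key t : n%:R < t ->
    `|a t - 2 * (m + rho) * A t| <= rho / 2 * (A t + B t) /\
    `|b t - 2 * (m - rho) * B t| <= rho / 2 * (A t + B t).
  move=> nt; have t0 : 0 < t by exact: le_lt_trans nt.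
  pose rt := r * expR (- (2 * SL_rate) * t).
  have small (x1 x2 : R -> C) : SL_curves x1 x2 -> nsq (x1 0) + nsq (x2 0) <= r ->
      nsq (x1 t) <= rt /\ nsq (x2 t) <= rt.
    move=> S E; have := SL_energy_decay S (ltW t0).
    have : (nsq (x1 0) + nsq (x2 0)) * expR (- (2 * SL_rate) * t) <= rt.
      by rewrite ler_wpM2r// expR_ge0.
    have := (nsq_ge0 (x1 t), nsq_ge0 (x2 t)); case=> /= ? ? ? ?; split; lra.
  have [z1t z2t] := small _ _ Sz Ez; have [y1t y2t] := small _ _ Sy Ey.
  have : SL_pert * rt * (A t + B t) <= rho / 2 * (A t + B t).
    apply: ler_wpM2r; first exact: addr_ge0.
    have := nP t (ltW nt); rewrite ler_pdivlMr// => h.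
    apply: le_trans h; rewrite ger0_norm// /rt.
    have := expR_ge0 (- (2 * SL_rate) * t); move: (expR _) => E E0.
    have -> : E * (SL_pert * (r + 1)) = SL_pert * (r * E) + SL_pert * E by ring.
    by rewrite lerDl mulr_ge0// ltW.
  have [h1 h2] := ab t rt t0 z1t z2t y1t y2t.
  by move=> h3; split; [exact: le_trans h1 h3|exact: le_trans h2 h3].
split=> [s t ns st|AB t nt].
  apply: (dfrom_expR_ge (dfromW n0 (dfromB Da Db)) _ ns st) => x nx.
  have [] := key x nx; rewrite !ler_norml -/(A x) -/(B x).
  have h1 : 0 <= rho * B x by rewrite mulr_ge0// ltW.
  move: (A x) (B x) h1 => A' B' h1; lra.
apply: (dfrom_expR_le (dfromW n0 Db) _ (lexx _) nt) => x nx.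
have [_] := key x nx; rewrite !ler_norml -/(B x).
have h1 : rho * A x <= rho * B x by rewrite ler_pM2l// AB// ltW.
move: (A x) (B x) h1 => A' B' h1; lra.
Qed.

Lemma slow_dist0 (z1 z2 : R -> C) t :
  slow_dist z1 z2 (fun=> 0) (fun=> 0) t = nsq (slow (z1 t) (z2 t)).
Proof. by rewrite /slow_dist !subr0. Qed.

Lemma fast_dist0 (z1 z2 : R -> C) t :
  fast_dist z1 z2 (fun=> 0) (fun=> 0) t = nsq (fast (z1 t) (z2 t)).
Proof. by rewrite /fast_dist !subr0. Qed.

Lemma slowB (z w z' w' : C) : slow (z - z') (w - w') = slow z w - slow z' w'.
Proof. by rewrite /slow; ring. Qed.

Lemma fastB (z w z' w' : C) : fast (z - z') (w - w') = fast z w - fast z' w'.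
Proof. by rewrite /fast; ring. Qed.

Definition fast_dominated (n : nat) (z1 z2 : R -> C) := forall t, n%:R <= t ->
  nsq (slow (z1 t) (z2 t)) <= nsq (fast (z1 t) (z2 t)).

(* Were the difference of two fast dominated solutions slow dominated at some
   time, it would decay too slowly. Hence at time n the fast dominated solutions
   form a Lipschitz graph over the fast coordinate. *)
Lemma fast_dominated_negligible (N : nat) : exists n : nat,
  (@lebesgue4 R).-negligible [set x0 | exists z1 z2,
    [/\ SL_solution alpha1 alpha2 omega1 omega2 kappa x0 z1 z2,
        nsq (z1 0) + nsq (z2 0) <= N%:R & fast_dominated n z1 z2]] /\
  forall z1 z2, SL_curves z1 z2 -> nsq (z1 0) + nsq (z2 0) <= N%:R ->
    ~ fast_dominated n z1 z2 -> exists2 t0, 0 <= t0 & forall t, t0 <= t ->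
      nsq (fast (z1 t) (z2 t)) < nsq (slow (z1 t) (z2 t)).
Proof.
have [n cone] := SL_cone N%:R; exists n; split; last first.
  move=> z1 z2 S E /existsNP[t0 /not_implyP[nt0 /negP]]; rewrite -ltNge => BA.
  have E00 : nsq (0 : C) + nsq (0 : C) <= N%:R by rewrite nsq0 addr0.
  have [coneA _] := cone _ _ _ _ S SL_curves0 E E00.
  exists t0 => [|t tt]; first exact: le_trans nt0.
  have := coneA _ _ nt0 tt; rewrite !slow_dist0 !fast_dist0 => H.
  by rewrite -subr_gt0; apply: lt_le_trans H; rewrite mulr_gt0 ?expR_gt0// subr_gt0.
have S00 := SL_curves0; have n0 : 0 <= n%:R :> R by [].
(* The fast coordinate supplies two real labels; the third is the dummy 0. *)
pose Q (z1 z2 : R -> C) T (p : R * R * R) := [/\ T = n%:R, fast_dominated n z1 z2 &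
  let v := fast (z1 T) (z2 T) in p = (complex.Re v, complex.Im v, 0)].
pose r := cst1 * (2 * N%:R).
have r0 : 0 <= r by rewrite mulr_ge0// mulr_ge0.
pose K := (Num.truncn (r + 1)).+1.
have rK : r + 1 < K%:R by exact: truncnS_gt.
have sq_le (x : R) : x ^+ 2 <= r -> `|x| <= (n + K)%:R.
  move=> h; have n1 : 1 <= (n + K)%:R :> R by rewrite ler1n addnS.
  have : r + 1 <= (n + K)%:R.
    by rewrite ltW// (lt_le_trans rK)// ler_nat leq_addl.
  move=> rK'; rewrite -(@ler_pXn2r _ 2)// ?nnegrE// real_normK ?num_real//.
  by rewrite (le_trans h)//; nra.
suff : (@lebesgue4 R).-negligible [set x0 | exists z1 z2 T p,
    [/\ SL_solution alpha1 alpha2 omega1 omega2 kappa x0 z1 z2,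
        nsq (z1 0) + nsq (z2 0) <= N%:R & Q z1 z2 T p]].
  apply: negligibleS => x0 [z1 [z2 [S E D]]]; exists z1, z2, n%:R.
  by exists (complex.Re (fast (z1 n%:R) (z2 n%:R)), complex.Im (fast (z1 n%:R) (z2 n%:R)), 0).
(* One factor 2 because the slow distance is at most the fast one, another for the two real
   coordinates of the latter. *)
have M0 : 0 <= cst0 * 4 by rewrite mulr_ge0.
apply: (@SL_negligible Q N%:R (cst0 * 4) (n + K) M0).
  move=> z1 z2 T p Cz Ez [-> _ ->]/=.
  split; first by rewrite n0 ler_nat leq_addr.
  rewrite normr0; have [e1 e2] := SL_nsq_le Cz Ez n0.
  have := slow_fast_le (z1 n%:R) (z2 n%:R).
  have := nsq_ge0 (slow (z1 n%:R) (z2 n%:R)).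
  have : cst1 * (nsq (z1 n%:R) + nsq (z2 n%:R)) <= r.
    by rewrite ler_wpM2l//; lra.
  rewrite -/cst1 [nsq (fast _ _)]/nsq => h1 h2 h3.
  have := sqr_ge0 (complex.Re (fast (z1 n%:R) (z2 n%:R))).
  have := sqr_ge0 (complex.Im (fast (z1 n%:R) (z2 n%:R))).
  by move=> h4 h5; split=> //; apply: sq_le; lra.
move=> z1 z2 T p y1 y2 S q G G0 Cz Ez [-> Dz ->] Cy Ey [-> Dy ->]/= g1 g2 _.
split; first by rewrite subrr normr0.
have [coneA _] := cone _ _ _ _ Cz Cy Ez Ey.
have E00 : nsq (0 : C) + nsq (0 : C) <= N%:R by rewrite nsq0 addr0.
have [_ coneZ] := cone _ _ _ _ Cz S00 Ez E00.
have [_ coneY] := cone _ _ _ _ Cy S00 Ey E00.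
have AB : slow_dist z1 z2 y1 y2 n%:R <= fast_dist z1 z2 y1 y2 n%:R.
  rewrite leNgt; apply/negP => BA.
  set q0 := slow_dist z1 z2 y1 y2 n%:R - fast_dist z1 z2 y1 y2 n%:R.
  have q00 : 0 < q0 by rewrite subr_gt0.
  pose M := 2 * (nsq (fast (z1 n%:R) (z2 n%:R)) + nsq (fast (y1 n%:R) (y2 n%:R))).
  (* The slow distance is at least [q0] times the exponential of rate [2 * m + rho], yet at most
     twice the sum of two fast coordinates of rate [2 * m - rho]; the quotient of the rates
     remains. *)
  have HM t : n%:R <= t -> q0 * expR (2 * rho * (t - n%:R)) <= M.
    move=> nt.
    have Dz' s : n%:R <= s -> slow_dist z1 z2 (fun=> 0) (fun=> 0) s <=
        fast_dist z1 z2 (fun=> 0) (fun=> 0) s.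
      by move=> ns; rewrite slow_dist0 fast_dist0 Dz.
    have Dy' s : n%:R <= s -> slow_dist y1 y2 (fun=> 0) (fun=> 0) s <=
        fast_dist y1 y2 (fun=> 0) (fun=> 0) s.
      by move=> ns; rewrite slow_dist0 fast_dist0 Dy.
    have := coneZ Dz' t nt; have := coneY Dy' t nt; rewrite !fast_dist0.
    set E := expR ((2 * m - rho) * (t - n%:R)) => hy hz.
    have := coneA _ _ (lexx _) nt; rewrite -/q0.
    have -> : expR ((2 * m + rho) * (t - n%:R)) = expR (2 * rho * (t - n%:R)) * E.
      by rewrite /E -expRD; congr expR; ring.
    have := nsqB_le (slow (z1 t) (z2 t)) (slow (y1 t) (y2 t)); rewrite -slowB.
    rewrite -/(slow_dist z1 z2 y1 y2 t) => h1 h2.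
    have B0 : 0 <= fast_dist z1 z2 y1 y2 t by exact: nsq_ge0.
    have h3 := Dz t nt; have h4 := Dy t nt.
    rewrite -(ler_pM2r (expR_gt0 ((2 * m - rho) * (t - n%:R)))) -/E /M.
    lra.
  have M0' : 0 <= M by apply: mulr_ge0 => //; apply: addr_ge0; exact: nsq_ge0.
  have r2 : 0 < 2 * rho by rewrite mulr_gt0.
  (* At this time the exponent is [M / q0], and [q0 * (1 + M / q0) = q0 + M] already exceeds [M]. *)
  have := HM (n%:R + M / (2 * rho * q0)); rewrite lerDl addrAC subrr add0r.
  have d0 : 0 <= M / (2 * rho * q0).
    by apply: divr_ge0 => //; apply: mulr_ge0; exact: ltW.
  rewrite d0 => /(_ isT).
  rewrite leNgt => /negP; apply.
  have -> : 2 * rho * (M / (2 * rho * q0)) = M / q0.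
    by field; rewrite !gt_eqF.
  have : q0 * (1 + M / q0) <= q0 * expR (M / q0) by rewrite ler_pM2l// expR_ge1Dx.
  apply: lt_le_trans; rewrite mulrDr mulr1 mulrCA divff ?gt_eqF// mulr1.
  by rewrite ltrDr.
rewrite (le_trans (slow_fast_ge _ _))// -/cst0 -(mulrA cst0) ler_wpM2l//.
have := AB; rewrite -/(slow_dist z1 z2 y1 y2 n%:R) -/(fast_dist z1 z2 y1 y2 n%:R).
rewrite [fast_dist _ _ _ _ _]/fast_dist fastB nsqB.
have sqG (x : R) : `|x| <= G -> x ^+ 2 <= G ^+ 2.
  by move=> h; rewrite -[_ ^+ 2]real_normK ?num_real// lerXn2r ?nnegrE.
have := sqG _ g1; have := sqG _ g2; lra.
Qed.

(* B / A is the squared modulus of fast / slow. *)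
Lemma SL_ratio_decay (z1 z2 : R -> C) t0 : SL_curves z1 z2 -> 0 <= t0 ->
  let A t := nsq (slow (z1 t) (z2 t)) in let B t := nsq (fast (z1 t) (z2 t)) in
  (forall t, t0 <= t -> B t < A t) ->
  exists c D, [/\ 0 < c, 0 <= D &
    forall t, t0 <= t -> B t / A t <= D * expR (- c * t)].
Proof.
move=> S t00 A B BA.
have [a [b [Da Db ab]]] := SL_difference S SL_curves0.
have EA : slow_dist z1 z2 (fun=> 0) (fun=> 0) = A.
  by apply/funext => t; rewrite slow_dist0.
have EB : fast_dist z1 z2 (fun=> 0) (fun=> 0) = B.
  by apply/funext => t; rewrite fast_dist0.
have B0 t : 0 <= B t by exact: nsq_ge0.
have A0 t : t0 <= t -> 0 < A t by move=> /BA; exact: le_lt_trans.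
have l0 := SL_rate_gt0; have P0 := SL_pert_gt0.
(* The ratio [q = B / A] satisfies [q' <= - 4 * rho * q + 4 * p] with [p] decaying at rate
   [2 * SL_rate]. The weight [expR (c * t)] is absorbed by the gap [4 * rho] and leaves a forcing of
   rate at least [SL_rate]. *)
pose c := Num.min SL_rate (4 * rho).
have c0 : 0 < c by rewrite lt_min l0 mulr_gt0.
have cl : c <= SL_rate by rewrite ge_min lexx.
have cr : c <= 4 * rho by rewrite ge_min lexx orbT.
pose E0 := nsq (z1 0) + nsq (z2 0).
have E00 : 0 <= E0 by apply: addr_ge0; exact: nsq_ge0.
pose D := 4 * SL_pert * E0.
have D0 : 0 <= D by rewrite mulr_ge0// mulr_ge0// ltW.
rewrite EA in Da; rewrite EB in Db.
have Dinv : dfrom t0 (fun t => (A t)^-1) (fun t => - a t / A t ^+ 2).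
  by apply: dfromV (dfromW t00 Da) => t /A0/gt_eqF ->.
have DR := dfromM (dfromW t00 Db) Dinv.
have DX := dfromB (dfromM (dfrom_expR t0 c) DR)
  (dfromZ (- (D / SL_rate)) (dfrom_expR t0 (- SL_rate))).
have := dfrom_nincr DX _ (lexx t0).
(* The second term is the tail integral of that forcing, which makes [F] nonincreasing. *)
set F := fun t => expR (c * t) * (B t / A t) - - (D / SL_rate) * expR (- SL_rate * t).
move=> H; have {}H : forall t, t0 <= t -> F t <= F t0.
  move=> t tt; apply: H => // s ts {tt t}.
  have s0 : 0 < s by exact: le_lt_trans ts.
  pose es := E0 * expR (- (2 * SL_rate) * s).
  have small : nsq (z1 s) <= es /\ nsq (z2 s) <= es.
    have := SL_energy_decay S (ltW s0); rewrite -/E0 -/es.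
    have := (nsq_ge0 (z1 s), nsq_ge0 (z2 s)); case=> /= ? ? ?; split; lra.
  have es0 : 0 <= es by rewrite mulr_ge0// expR_ge0.
  have [] := ab s es s0 (proj1 small) (proj2 small).
  - by rewrite nsq0.
  - by rewrite nsq0.
  rewrite EA EB; have As := A0 s (ltW ts); have Bs := B0 s.
  have BAs := ltW (BA s (ltW ts)).
  move: (A s) (B s) (a s) (b s) As Bs BAs => A' B' a' b' A'0 B'0 BA' Ha Hb.
  set q := B' / A'; have q0 : 0 <= q by rewrite divr_ge0// ltW.
  set p := SL_pert * es in Ha Hb.
  have p0 : 0 <= p by apply: mulr_ge0 => //; exact: ltW.
  have P1 : p * (A' + B') <= p * (2 * A') by apply: ler_wpM2l => //; lra.
  have dR : b' * A'^-1 + B' * (- a' / A' ^+ 2) <= - 4 * rho * q + 4 * p.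
    have -> : b' * A'^-1 + B' * (- a' / A' ^+ 2) = (b' * A' - B' * a') / A' ^+ 2.
      by field; rewrite gt_eqF.
    rewrite ler_pdivrMr ?exprn_gt0//.
    have -> : (- 4 * rho * q + 4 * p) * A' ^+ 2 =
        - 4 * rho * (A' * B') + 4 * p * A' ^+ 2.
      by rewrite /q; field; rewrite gt_eqF.
    have h1 : b' * A' <= (2 * (m - rho) * B' + p * (2 * A')) * A'.
      by rewrite ler_wpM2r ?(ltW A'0)//; move: Hb; rewrite ler_norml; lra.
    have h2 : B' * (2 * (m + rho) * A' - p * (2 * A')) <= B' * a'.
      by rewrite ler_wpM2l//; move: Ha; rewrite ler_norml; lra.
    have h3 : p * A' * B' <= p * A' * A' by rewrite ler_wpM2l// mulr_ge0// ltW.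
    nra.
  have Ec := expR_gt0 (c * s).
  have h4 : expR (c * s) * (b' * A'^-1 + B' * (- a' / A' ^+ 2)) <=
      expR (c * s) * (- 4 * rho * q + 4 * p) by rewrite ler_pM2l.
  have h5 : 0 <= expR (c * s) * ((4 * rho - c) * q).
    by rewrite mulr_ge0 ?(ltW Ec)// mulr_ge0// subr_ge0.
  have h6 : expR (c * s) * (4 * p) <= D * expR (- SL_rate * s).
    have -> : expR (c * s) * (4 * p) = D * (expR (c * s) * expR (- (2 * SL_rate) * s)).
      by rewrite /p /es /D; ring.
    rewrite ler_wpM2l// -expRD ler_expR -mulrDl ler_wpM2r ?(ltW s0)//; lra.
  have -> : - (D / SL_rate) * (- SL_rate * expR (- SL_rate * s)) =
      D * expR (- SL_rate * s) by field; rewrite gt_eqF.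
  lra.
have DE0 t : 0 <= D / SL_rate * expR (- SL_rate * t).
  by rewrite mulr_ge0 ?expR_ge0// divr_ge0// ltW.
exists c, (F t0); split=> //.
  rewrite /F mulNr opprK addr_ge0// mulr_ge0 ?expR_ge0// divr_ge0//.
  by rewrite ltW// A0.
move=> t tt; rewrite mulNr expRN ler_pdivlMr ?expR_gt0// mulrC.
by have := H t tt; have := DE0 t; rewrite /F; lra.
Qed.

(** The two differences are exactly [fast / (k * z1)] and [- fast / (e * z2)]. Once [fast] is small
    against [slow], both oscillators are bounded below by multiples of [slow]. The rate is halved
    because [SL_ratio_decay] bounds a squared modulus. *)
Lemma SL_ratio_cvg (z1 z2 : R -> C) t0 : SL_curves z1 z2 -> 0 <= t0 ->
  (forall t, t0 <= t -> nsq (fast (z1 t) (z2 t)) < nsq (slow (z1 t) (z2 t))) ->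
  exists c D t1, [/\ 0 < c, 0 <= t1 & forall t, t1 <= t ->
    nsq (z2 t / z1 t - e / k%:C%C) <= (D * expR (- c * t)) ^+ 2 /\
    nsq (z1 t / z2 t - k%:C%C / e) <= (D * expR (- c * t)) ^+ 2].
Proof.
move=> S t00 BA; have [c [D [c0 D0 HD]]] := SL_ratio_decay S t00 BA.
set K := k%:C%C.
have K0 : K != 0 by rewrite eq_complex/= gt_eqF.
have nK : nsq K = k ^+ 2 by rewrite nsq_real.
have e0 : e != 0.
  by apply/eqP => e0; move: nsq_det_gt0; rewrite e0 mulr0 mul0r nsq0 ltxx.
have nK0 : 0 < nsq K by exact: nsq_gt0.
have ne0 : 0 < nsq e by exact: nsq_gt0.
have Nd := nsq_det_gt0; set Delta := nsq _ in Nd.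
(* These thresholds make the fast term at most a quarter of the slow one in each inversion formula;
   [halfB] and [halfD] then leave another quarter. [D + 1] is used because [D] may be 0. *)
pose eta := Num.min (nsq K / 4 / nsq e) (nsq e / 4 / nsq K) / (D + 1).
have eta0 : 0 < eta.
  by rewrite divr_gt0 ?ltr_wpDl// lt_min !divr_gt0.
have [n nP] := expR_small c0 eta0.
pose D' := Num.sqrt (4 * Delta / nsq K / nsq K + 4 * Delta / nsq e / nsq e) * Num.sqrt D.
exists (c / 2), D', (Num.max t0 n%:R); split; [by rewrite divr_gt0|by rewrite le_max t00|].
move=> t; rewrite ge_max => /andP[tt nt].
set u := slow (z1 t) (z2 t); set v := fast (z1 t) (z2 t).
have A0 : 0 < nsq u by rewrite (le_lt_trans (nsq_ge0 v))// BA.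
have B0 := nsq_ge0 v.
have BD : nsq v <= D * expR (- c * t) * nsq u.
  by have := HD t tt; rewrite ler_pdivrMr.
have E0 := expR_ge0 (- c * t).
have Dmin : D * expR (- c * t) <= Num.min (nsq K / 4 / nsq e) (nsq e / 4 / nsq K).
  have := nP t nt; rewrite /eta ler_pdivlMr ?ltr_wpDl// mulrDr mulr1 mulrC; lra.
have [D1 D2] : D * expR (- c * t) * nsq e <= nsq K / 4 /\
    D * expR (- c * t) * nsq K <= nsq e / 4.
  by move: Dmin; rewrite le_min !ler_pdivlMr// => /andP[].
have Bu (x : R) (y : R) : 0 < x -> D * expR (- c * t) * x <= y / 4 -> x * nsq v <= y / 4 * nsq u.
  move=> x0 h; rewrite (le_trans (ler_wpM2l (ltW x0) BD))// mulrA ler_wpM2r ?(ltW A0)//.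
  by rewrite mulrC.
have halfB (x y : C) : nsq x / 2 - nsq y <= nsq (x - y).
  have := nsqD_le (x - y) y; rewrite subrK; lra.
have halfD (x y : C) : nsq x / 2 - nsq y <= nsq (x + y).
  have := halfB x (- y); rewrite nsqN opprK; lra.
have L1 : nsq K / 4 * nsq u <= Delta * nsq (z1 t).
  rewrite -nsqM (slow_fastKl (z1 t) (z2 t)) -/u -/v -/K.
  have := halfB (K * u) (e * v); have := Bu _ _ ne0 D1; rewrite !nsqM; lra.
have L2 : nsq e / 4 * nsq u <= Delta * nsq (z2 t).
  rewrite -nsqM (slow_fastKr (z1 t) (z2 t)) -/u -/v -/K.
  have := halfD (e * u) (K * v); have := Bu _ _ nK0 D2; rewrite !nsqM; lra.
have N1 : 0 < nsq (z1 t).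
  by rewrite -(pmulr_rgt0 _ Nd) (lt_le_trans _ L1)// mulr_gt0// divr_gt0.
have N2 : 0 < nsq (z2 t).
  by rewrite -(pmulr_rgt0 _ Nd) (lt_le_trans _ L2)// mulr_gt0// divr_gt0.
have z10 : z1 t != 0 by rewrite -nsq_eq0 gt_eqF.
have z20 : z2 t != 0 by rewrite -nsq_eq0 gt_eqF.
have X1 : 0 <= 4 * Delta / nsq K / nsq K.
  by rewrite divr_ge0 ?(ltW nK0)// divr_ge0 ?(ltW nK0)// mulr_ge0// ltW.
have X2 : 0 <= 4 * Delta / nsq e / nsq e.
  by rewrite divr_ge0 ?(ltW ne0)// divr_ge0 ?(ltW ne0)// mulr_ge0// ltW.
have D'E : (D' * expR (- (c / 2) * t)) ^+ 2 =
    (4 * Delta / nsq K / nsq K + 4 * Delta / nsq e / nsq e) * (D * expR (- c * t)).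
  rewrite /D' !exprMn !sqr_sqrtr ?addr_ge0// -mulrA; congr (_ * (_ * _)).
  by rewrite expr2 -expRD; congr expR; field.
rewrite D'E.
have bound (x : R) (w : C) : 0 < x -> x / 4 * nsq u <= Delta * nsq w -> 0 < nsq w ->
    nsq v / (x * nsq w) <= 4 * Delta / x / x * (D * expR (- c * t)).
  move=> x0 xw w0; rewrite ler_pdivrMr ?mulr_gt0// (le_trans BD)//.
  have -> : 4 * Delta / x / x * (D * expR (- c * t)) * (x * nsq w) =
      D * expR (- c * t) * (4 / x * (Delta * nsq w)) by field; rewrite gt_eqF.
  rewrite ler_wpM2l ?mulr_ge0//.
  have -> : nsq u = 4 / x * (x / 4 * nsq u) by field; rewrite gt_eqF.
  by rewrite ler_wpM2l// divr_ge0// ltW.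
split.
  have -> : z2 t / z1 t - e / K = v / (K * z1 t).
    by rewrite /v /fast -/K; field; rewrite K0 z10.
  rewrite nsq_div nsqM (le_trans (bound _ _ nK0 L1 N1))// ler_wpM2r ?mulr_ge0//.
  by rewrite lerDl.
have -> : z1 t / z2 t - K / e = - (v / (e * z2 t)).
  by rewrite /v /fast -/K; field; rewrite e0 z20.
rewrite nsqN nsq_div nsqM (le_trans (bound _ _ ne0 L2 N2))// ler_wpM2r ?mulr_ge0//.
by rewrite lerDr.
Qed.

(** Here [theta] is minus an argument of [e]. The exponentially small derivative of [phi1 - phi2]
    gives a limit [l]; the limit of [z2 / z1] identifies it modulo [2 * pi]. *)
Lemma SL_phase_locking (z1 z2 : R -> C) t0 (theta : R) : SL_curves z1 z2 ->
  (forall t, 0 <= t -> z1 t != 0) -> (forall t, 0 <= t -> z2 t != 0) -> 0 <= t0 ->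
  (forall t, t0 <= t -> nsq (fast (z1 t) (z2 t)) < nsq (slow (z1 t) (z2 t))) ->
  cos theta * Num.sqrt (nsq e) = complex.Re e ->
  sin theta * Num.sqrt (nsq e) = - complex.Im e ->
  phase_locking z1 z2 theta.
Proof.
move=> S z10 z20 t00 BA cosE sinE; have [D1 D2] := S.
have N10 t : 0 <= t -> 0 < nsq (z1 t) by move=> /z10; exact: nsq_gt0.
have N20 t : 0 <= t -> 0 < nsq (z2 t) by move=> /z20; exact: nsq_gt0.
have [c [D [t1 [c0 t10 HD]]]] := SL_ratio_cvg S t00 BA.
set K := k%:C%C in HD; have K0 : K != 0 by rewrite eq_complex/= gt_eqF.
have e0 : e != 0.
  by apply/eqP => e0; move: nsq_det_gt0; rewrite e0 mulr0 mul0r nsq0 ltxx.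
pose f1 t := omega1 + k * (crossc (z1 t) (z2 t) / nsq (z1 t)).
pose f2 t := omega2 + k * (crossc (z2 t) (z1 t) / nsq (z2 t)).
(* The growth and cubic terms are radial, so the angular velocity is [o] plus [k] times the
   imaginary part of [w / z]. *)
have lift (a o : R) (z w dz dw : R -> C) : cfrom 0 z dz -> cfrom 0 w dw ->
    (forall t, 0 <= t -> z t != 0) ->
    (forall t, dz t = SL_field a o kappa (z t) (w t)) ->
    exists2 phi, is_phase z phi &
      dfrom 0 phi (fun t => o + k * (crossc (z t) (w t) / nsq (z t))).
  move=> Dz Dw z0 dzE; apply: (phase_lift Dz z0).
    have nz t : 0 <= t -> nsq (z t) != 0 by move=> /z0; rewrite nsq_eq0.
    by have [] := dfromD (dfrom_cst 0 o) (dfromZ k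
      (dfromM (dfrom_crossc Dz Dw) (dfromV nz (dfrom_nsq Dz)))).
  move=> t t0'; rewrite dzE SL_fieldE -/k mulrDl -mulrA divfK ?nsq_eq0 ?z0 ?ltW//.
  case: (z t) => x y; case: (w t) => x' y'.
  by rewrite /crossc /cubic /nsq/=; ring.
have [phi1 P1 Dphi1] := lift _ _ _ _ _ _ D1 D2 z10 (fun=> erefl).
have [phi2 P2 Dphi2] := lift _ _ _ _ _ _ D2 D1 z20 (fun=> erefl).
have DPhi := dfromB Dphi1 Dphi2.
pose Phi t := phi1 t - phi2 t.
have E0 t := expR_ge0 (- c * t).
have Dpos : 0 <= `|D| by [].
have bRe (x : C) t : nsq x <= (D * expR (- c * t)) ^+ 2 ->
    `|complex.Re x| <= `|D| * expR (- c * t) /\ `|complex.Im x| <= `|D| * expR (- c * t).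
  move=> h; have p0 : 0 <= `|D| * expR (- c * t) by rewrite mulr_ge0.
  have h' : nsq x <= (`|D| * expR (- c * t)) ^+ 2.
    by rewrite exprMn real_normK ?num_real// -exprMn.
  have := (sqr_ge0 (complex.Re x), sqr_ge0 (complex.Im x)); case=> /= r0 i0.
  by split; rewrite -(@ler_pXn2r _ 2)// ?nnegrE// real_normK ?num_real//;
    move: h'; rewrite /nsq; lra.
(* On the slow eigenvector both oscillators rotate at the same speed: by [eE], [K * K / e] is
   [e + 2 * delta], and twice the imaginary part of [delta] is [omega1 - omega2]. *)
have base : omega1 - omega2 + k * complex.Im (e / K) - k * complex.Im (K / e) = 0.
  have ImK (x : C) : k * complex.Im x = complex.Im (K * x).
    by rewrite ImM /K/= mul0r addr0.
  rewrite !ImK [K * (e / K)]mulrC divfK// mulrA eE [e * _]mulrC mulfK//.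
  by case: (e) => x y; rewrite /delta/=; field.
have [l Hl] : exists l : R, Phi t @[t --> +oo] --> l.
  apply: (@dfrom_exp_cvg R t1 c (2 * k * `|D|) _ _ c0 (dfromW t10 DPhi)).
  move=> t tt; have [h1 h2] := HD t (ltW tt).
  have [_ i1] := bRe _ _ h1; have [_ i2] := bRe _ _ h2.
  rewrite -!Im_div.
  have -> : omega1 + k * complex.Im (z2 t / z1 t) - (omega2 + k * complex.Im (z1 t / z2 t)) =
      k * (complex.Im (z2 t / z1 t - e / K) - complex.Im (z1 t / z2 t - K / e)).
    have ImB (x y : C) : complex.Im (x - y) = complex.Im x - complex.Im y.
      by case: x; case: y.
    apply/eqP; rewrite -subr_eq0 -[X in _ == X]base !ImB; apply/eqP.
    move: (complex.Im (z2 t / z1 t)) (complex.Im (z1 t / z2 t)) => x y.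
    by move: (complex.Im (e / K)) (complex.Im (K / e)) => p q; ring.
  rewrite normrM gtr0_norm//.
  have -> : 2 * k * `|D| * expR (- c * t) = k * (2 * (`|D| * expR (- c * t))).
    by ring.
  rewrite ler_pM2l// (le_trans (ler_normB _ _))//.
  by move: i1 i2; lra.
have cRe : complex.Re (z2 t / z1 t) @[t --> +oo] --> complex.Re (e / K).
  apply: (@cvg_expR_bound R t1 c `|D|) => // t tt; have [h1 _] := HD t tt.
  by have [+ _] := bRe _ _ h1; rewrite raddfB.
have cIm : complex.Im (z2 t / z1 t) @[t --> +oo] --> complex.Im (e / K).
  apply: (@cvg_expR_bound R t1 c `|D|) => // t tt; have [h1 _] := HD t tt.
  by have [_] := bRe _ _ h1; rewrite raddfB.
have cN : Num.sqrt (nsq (z2 t / z1 t)) @[t --> +oo] --> Num.sqrt (nsq (e / K)).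
  have nsqE (x : C) : nsq x =
      complex.Re x * complex.Re x + complex.Im x * complex.Im x.
    by rewrite /nsq !expr2.
  have c2 : nsq (z2 t / z1 t) @[t --> +oo] --> nsq (e / K).
    under eq_fun do rewrite nsqE; rewrite nsqE.
    by apply: cvgD; [exact: (cvgM cRe cRe)|exact: (cvgM cIm cIm)].
  by apply: cvg_comp c2 _; exact: sqrt_continuous.
have polar t : 0 <= t ->
    cos (Phi t) * Num.sqrt (nsq (z2 t / z1 t)) = complex.Re (z2 t / z1 t) /\
    - (sin (Phi t) * Num.sqrt (nsq (z2 t / z1 t))) = complex.Im (z2 t / z1 t).
  move=> t0'; have [_ zE1] := P1.2 t t0'; have [_ zE2] := P2.2 t t0'.
  have r10 : 0 < Num.sqrt (nsq (z1 t)) by rewrite sqrtr_gt0 N10.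
  have n1 : nsq (z1 t) = Num.sqrt (nsq (z1 t)) ^+ 2 by rewrite sqr_sqrtr ?nsq_ge0.
  rewrite normc_nsq in zE1; rewrite normc_nsq in zE2.
  have RI (r a b : R) (z : C) : z = r%:C%C * (a +i* b)%C ->
      complex.Re z = r * a /\ complex.Im z = r * b.
    by move=> ->; rewrite /= !mul0r subr0 addr0.
  have [x1 y1] := RI _ _ _ _ zE1; have [x2 y2] := RI _ _ _ _ zE2.
  rewrite nsq_div sqrtrM ?nsq_ge0// sqrtrV ?nsq_ge0// Re_div Im_div.
  rewrite /dotc /crossc x1 y1 x2 y2.
  move: (Num.sqrt (nsq (z1 t))) (Num.sqrt (nsq (z2 t))) n1 r10 => r s -> r0.
  rewrite /Phi cosB sinB.
  by split; field; rewrite gt_eqF.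
have near_ge0 (P : R -> Prop) : (forall t, 0 <= t -> P t) -> \forall t \near +oo, P t.
  move=> H; near=> t; apply: H; near: t; apply: nbhs_pinfty_ge; exact: num_real.
have cosl : cos l * Num.sqrt (nsq (e / K)) = complex.Re (e / K).
  have cl : cos (Phi t) * Num.sqrt (nsq (z2 t / z1 t)) @[t --> +oo] -->
      cos l * Num.sqrt (nsq (e / K)).
    by apply: cvgM cN; apply: cvg_comp Hl _; exact: continuous_cos.
  apply: (cvg_unique _ cl) => //; apply: cvg_trans cRe; apply: near_eq_cvg.
  by apply: near_ge0 => t /polar[->].
have sinl : - (sin l * Num.sqrt (nsq (e / K))) = complex.Im (e / K).
  have sl : - (sin (Phi t) * Num.sqrt (nsq (z2 t / z1 t))) @[t --> +oo] -->
      - (sin l * Num.sqrt (nsq (e / K))).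
    by apply: cvgN; apply: cvgM cN; apply: cvg_comp Hl _; exact: continuous_sin.
  apply: (cvg_unique _ sl) => //; apply: cvg_trans cIm; apply: near_eq_cvg.
  by apply: near_ge0 => t /polar[_ ->].
have L0 : 0 < Num.sqrt (nsq e) by rewrite sqrtr_gt0 nsq_gt0.
have sqE : Num.sqrt (nsq (e / K)) = Num.sqrt (nsq e) / k.
  by rewrite nsq_div sqrtrM ?nsq_ge0// sqrtrV ?nsq_ge0// nsq_real sqrtr_sqr gtr0_norm.
have eKE : e / K = (complex.Re e / k +i* (complex.Im e / k))%C.
  apply: (mulIf K0); rewrite divfK//; apply/eqP; rewrite eq_complex/=.
  by rewrite !mulr0 subr0 add0r !(divfK (lt0r_neq0 k0)) !eqxx.
have cos_eq : cos l = cos theta.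
  apply: (mulIf (lt0r_neq0 L0)); rewrite cosE.
  have := cosl; rewrite sqE eKE/= mulrA => /(mulIf (invr_neq0 (lt0r_neq0 k0))).
  exact.
have sin_eq : sin l = sin theta.
  apply: (mulIf (lt0r_neq0 L0)); rewrite sinE.
  have := sinl; rewrite sqE eKE/= mulrA -mulNr => /(mulIf (invr_neq0 (lt0r_neq0 k0))).
  by move=> <-; rewrite opprK.
(* [l] and [theta] have the same cosine and sine, so shifting [phi1] by [l - theta] leaves it a
   phase and makes the limit exactly [theta]. *)
exists (fun t => phi1 t - (l - theta)), phi2; split=> //.
  split=> [|t t0'].
    by apply: (dfromB Dphi1 (dfrom_cst 0 (l - theta))).1.
  have [z10' zE] := P1.2 t t0'; split=> //.
  have cd : cos (l - theta) = 1 by rewrite cosB cos_eq sin_eq -!expr2 cos2Dsin2.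
  have sd : sin (l - theta) = 0 by rewrite sinB cos_eq sin_eq mulrC subrr.
  by rewrite (cosB (phi1 t)) (sinB (phi1 t)) cd sd !mulr1 !mulr0 addr0 subr0.
have -> : (fun t => phi1 t - (l - theta) - phi2 t) = (fun t => Phi t - (l - theta)).
  by apply/funext => t; rewrite /Phi; ring.
have -> : theta = l - (l - theta) by ring.
rewrite {1}(_ : l - (l - theta) = theta); last by ring.
by apply: cvgB Hl _; exact: cvg_cst.
Unshelve. all: by end_near. Qed.

End StuartLandau.

(** * Existence of solutions by truncating the cubic term *)

Section Existence.
Variable R : realType.
Local Notation C := R[i].
Implicit Types (a b : bool * bool -> R).

Definition clamp (K x : R) := Num.max (- K) (Num.min x K).

Lemma clamp_id (K x : R) : `|x| <= K -> clamp K x = x.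
Proof.
by rewrite ler_norml /clamp => /andP[? ?]; rewrite min_l// max_r.
Qed.

Lemma clamp_norm_le (K x : R) : 0 <= K -> `|clamp K x| <= K.
Proof.
move=> K0; rewrite ler_norml /clamp le_max lexx/= ge_max ge_min lexx orbT andbT.
by lra.
Qed.

Lemma clamp_lipschitz (K x y : R) : `|clamp K x - clamp K y| <= `|x - y|.
Proof.
wlog yx : x y / y <= x.
  by move=> H; have [/H//|/ltW/H] := leP y x; rewrite distrC (distrC x).
rewrite (ger0_norm (x := x - y)) ?subr_ge0// ler_norml /clamp !maxEle !minEle.
case: (leP x K) => ?; case: (leP y K) => ?; case: (leP (- K) x) => ?;
  case: (leP (- K) y) => ?; case: (leP (- K) K) => ?; lra.
Qed.

(** Clamping preserves signs, so the truncated cubic term still dissipates energy. *)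
Lemma mul_clamp_ge0 (K x : R) : 0 <= K -> 0 <= x * clamp K x.
Proof.
move=> K0; have [x0|x0] := leP 0 x.
  by rewrite mulr_ge0// /clamp le_max le_min x0 K0 orbT.
rewrite -mulrNN mulr_ge0// ?oppr_ge0 ?(ltW x0)// /clamp ge_max oppr_le0 K0/=.
by rewrite ge_min (ltW x0).
Qed.

Lemma cubic_diff_le (K B p q r p' q' r' : R) : 0 <= K ->
  `|p| <= K -> `|q| <= K -> `|r| <= K -> `|p'| <= K -> `|q'| <= K -> `|r'| <= K ->
  `|p - p'| <= B -> `|q - q'| <= B -> `|r - r'| <= B ->
  `|(p ^+ 2 + q ^+ 2) * r - (p' ^+ 2 + q' ^+ 2) * r'| <= 6 * K ^+ 2 * B.
Proof.
move=> K0 pK qK rK p'K q'K r'K pB qB rB.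
have B0 : 0 <= B by rewrite (le_trans _ pB).
have one (x y : R) : `|x| <= K -> `|y| <= K -> `|x - y| <= B ->
    `|x ^+ 2 * r - y ^+ 2 * r'| <= 3 * K ^+ 2 * B.
  move=> xK yK xyB.
  have -> : x ^+ 2 * r - y ^+ 2 * r' = (x + y) * (x - y) * r + y ^+ 2 * (r - r').
    by ring.
  rewrite (le_trans (ler_normD _ _))//.
  rewrite (normrM (_ * _)) (normrM (x + y)) (normrM (y ^+ 2)) normrX.
  have h1 : `|x + y| <= K + K by rewrite (le_trans (ler_normD _ _))// lerD.
  have h2 : `|x + y| * `|x - y| * `|r| <= (K + K) * B * K.
    by rewrite ler_pM ?mulr_ge0// ler_pM.
  have h3 : `|y| ^+ 2 * `|r - r'| <= K ^+ 2 * B.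
    by rewrite ler_pM ?exprn_ge0// lerXn2r ?nnegrE.
  have -> : 3 * K ^+ 2 * B = (K + K) * B * K + K ^+ 2 * B by ring.
  exact: lerD.
have -> : (p ^+ 2 + q ^+ 2) * r - (p' ^+ 2 + q' ^+ 2) * r' =
  (p ^+ 2 * r - p' ^+ 2 * r') + (q ^+ 2 * r - q' ^+ 2 * r') by ring.
have -> : 6 * K ^+ 2 * B = 3 * K ^+ 2 * B + 3 * K ^+ 2 * B by ring.
by rewrite (le_trans (ler_normD _ _))// lerD// one.
Qed.

Variables alpha1 alpha2 omega1 omega2 kappa : R.
Hypotheses (halpha : alpha2 < alpha1) (halpha1 : alpha1 <= 0) (hkappa : 0 < kappa).

Let alpha (j : bool) := if j then alpha2 else alpha1.
Let omega (j : bool) := if j then omega2 else omega1.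

(* The index (j, c) selects the oscillator j and its real (c = false) or
   imaginary part; truncating the cubic term makes the field globally
   Lipschitz and keeps the energy nonincreasing. *)
Let F K (i : bool * bool) a : R :=
  alpha i.1 * a i +
  (if i.2 then omega i.1 else - omega i.1) * a (i.1, ~~ i.2) -
  (clamp K (a (i.1, false)) ^+ 2 + clamp K (a (i.1, true)) ^+ 2) * clamp K (a i) +
  kappa / 2 * (a (~~ i.1, i.2) - a i).

Let F_lip K : 0 <= K -> exists2 L, 0 < L & forall i a b B,
  (forall j, `|a j - b j| <= B) -> `|F K i a - F K i b| <= L * B.
Proof.
move=> K0; exists (`|alpha1| + `|alpha2| + `|omega1| + `|omega2| + 6 * K ^+ 2 + kappa).
  by rewrite ltr_wpDl// !addr_ge0// mulr_ge0// sqr_ge0.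
move=> [j c] a b B H; have B0 : 0 <= B by rewrite (le_trans _ (H (j, c))).
set n1 := alpha j * (a (j, c) - b (j, c)).
set n2 := (if c then omega j else - omega j) * (a (j, ~~ c) - b (j, ~~ c)).
set n3 := (clamp K (a (j, false)) ^+ 2 + clamp K (a (j, true)) ^+ 2) * clamp K (a (j, c))
  - (clamp K (b (j, false)) ^+ 2 + clamp K (b (j, true)) ^+ 2) * clamp K (b (j, c)).
set n4 := kappa / 2 * ((a (~~ j, c) - b (~~ j, c)) - (a (j, c) - b (j, c))).
have -> : F K (j, c) a - F K (j, c) b = n1 + n2 - n3 + n4.
  by rewrite /F /n1 /n2 /n3 /n4/=; ring.
have h1 : `|n1| <= (`|alpha1| + `|alpha2|) * B.
  rewrite normrM ler_pM// /alpha; case: (j); [rewrite lerDr|rewrite lerDl]; exact: normr_ge0.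
have h2 : `|n2| <= (`|omega1| + `|omega2|) * B.
  rewrite normrM ler_pM// /omega; case: (c); case: (j); rewrite ?normrN;
    rewrite ?lerDr ?lerDl; exact: normr_ge0.
have cl i : `|clamp K (a i) - clamp K (b i)| <= B.
  exact: le_trans (clamp_lipschitz _ _ _) (H i).
have h3 : `|n3| <= 6 * K ^+ 2 * B.
  by apply: cubic_diff_le; rewrite ?clamp_norm_le.
have h4 : `|n4| <= kappa * B.
  have k2 : 0 <= kappa / 2 by rewrite divr_ge0// ltW.
  rewrite normrM ger0_norm// (le_trans (ler_wpM2l k2 (ler_normB _ _)))//.
  have := lerD (H (~~ j, c)) (H (j, c)) => h.
  have -> : kappa * B = kappa / 2 * (B + B) by field.
  exact: ler_wpM2l.
rewrite (le_trans (ler_normD _ _))// (le_trans (lerD (ler_normB _ _) (lexx _)))//.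
rewrite (le_trans (lerD (lerD (ler_normD _ _) (lexx _)) (lexx _)))//.
lra.
Qed.

Lemma SL_solution_exists (x0 : (R * R) * (R * R)) : exists z1 z2 : R -> C,
  SL_solution alpha1 alpha2 omega1 omega2 kappa x0 z1 z2.
Proof.
pose E0 := x0.1.1 ^+ 2 + x0.1.2 ^+ 2 + (x0.2.1 ^+ 2 + x0.2.2 ^+ 2).
have E00 : 0 <= E0 by rewrite !addr_ge0 ?sqr_ge0.
(* As [E0 <= K ^+ 2], the energy bound keeps every coordinate within [K], where the clamp is the
   identity. *)
pose K := E0 + 1; have K0 : 0 <= K by rewrite addr_ge0.
have [L L0 Flip] := F_lip K0.
pose a0 (i : bool * bool) : R :=
  if i.1 then (if i.2 then x0.2.2 else x0.2.1) else (if i.2 then x0.1.2 else x0.1.1).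
have [y yP] := picard_global L0 Flip a0.
have y0 i : y i 0 = a0 i by have [] := yP i.
have Dy i : dfrom 0 (y i) (fun t => F K i (fun j => y j t)) by have [] := yP i.
pose f i t := y i t ^+ 2.
have Df := dfromD (dfromD (dfromX2 (Dy (false, false))) (dfromX2 (Dy (false, true))))
  (dfromD (dfromX2 (Dy (true, false))) (dfromX2 (Dy (true, true)))).
have E_le t : 0 <= t -> f (false, false) t + f (false, true) t +
    (f (true, false) t + f (true, true) t) <= E0.
  move=> t0; have := dfrom_nincr Df _ (lexx 0) t0; rewrite !y0/= => H.
  apply: H => s s0; rewrite /F/=.
  set p := y (false, false) s; set q := y (false, true) s.
  set u := y (true, false) s; set v := y (true, true) s.
  have hp := mul_clamp_ge0 p K0; have hq := mul_clamp_ge0 q K0.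
  have hu := mul_clamp_ge0 u K0; have hv := mul_clamp_ge0 v K0.
  set cp := clamp K p in hp *; set cq := clamp K q in hq *.
  set cu := clamp K u in hu *; set cv := clamp K v in hv *.
  have s1 : 0 <= (cp ^+ 2 + cq ^+ 2) * (p * cp + q * cq).
    by rewrite mulr_ge0 ?addr_ge0 ?sqr_ge0.
  have s2 : 0 <= (cu ^+ 2 + cv ^+ 2) * (u * cu + v * cv).
    by rewrite mulr_ge0 ?addr_ge0 ?sqr_ge0.
  have s3 : 0 <= kappa * ((p - u) ^+ 2 + (q - v) ^+ 2).
    by rewrite mulr_ge0 ?addr_ge0 ?sqr_ge0// ltW.
  have s4 : 0 <= - alpha1 * (p ^+ 2 + q ^+ 2).
    by rewrite mulr_ge0 ?addr_ge0 ?sqr_ge0// oppr_ge0.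
  have s5 : 0 <= - alpha2 * (u ^+ 2 + v ^+ 2).
    by rewrite mulr_ge0 ?addr_ge0 ?sqr_ge0// oppr_ge0 ltW// (lt_le_trans halpha).
  rewrite -oppr_ge0 [leRHS](_ : _ =
    2 * (- alpha1 * (p ^+ 2 + q ^+ 2)) + 2 * (- alpha2 * (u ^+ 2 + v ^+ 2)) +
    kappa * ((p - u) ^+ 2 + (q - v) ^+ 2) +
    2 * ((cp ^+ 2 + cq ^+ 2) * (p * cp + q * cq)) +
    2 * ((cu ^+ 2 + cv ^+ 2) * (u * cu + v * cv))); first by lra.
  by rewrite /alpha /omega; field.
have y_le i t : 0 <= t -> `|y i t| <= K.
  move=> /E_le; rewrite /f => H.
  rewrite -(@ler_pXn2r _ 2)// ?nnegrE// real_normK ?num_real//.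
  have := (sqr_ge0 (y (false, false) t), sqr_ge0 (y (false, true) t)).
  have := (sqr_ge0 (y (true, false) t), sqr_ge0 (y (true, true) t)).
  case=> /= ? ? [/= ? ?]; have : E0 <= K ^+ 2 by rewrite /K; nra.
  by case: i => [[] []]; lra.
exists (fun t => (y (false, false) t +i* y (false, true) t)%C).
exists (fun t => (y (true, false) t +i* y (true, true) t)%C).
split.
- have cy i : {within `[0, +oo[, continuous (y i)} by have [] := Dy i.
  by split; split; [exact: (cy (false, false))|exact: (cy (false, true))|
    exact: (cy (true, false))|exact: (cy (true, true))].
- by rewrite !y0.
- by rewrite !y0.
move=> t t0; have cl i : clamp K (y i t) = y i t by rewrite clamp_id// y_le// ltW.
split; split; rewrite !SL_fieldE /=.
- have [_ /(_ t t0)] := Dy (false, false); rewrite /F/= !cl; congr is_derive.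
  by rewrite /cubic /nsq/=; ring.
- have [_ /(_ t t0)] := Dy (false, true); rewrite /F/= !cl; congr is_derive.
  by rewrite /cubic /nsq/=; ring.
- have [_ /(_ t t0)] := Dy (true, false); rewrite /F/= !cl; congr is_derive.
  by rewrite /cubic /nsq/=; ring.
- have [_ /(_ t t0)] := Dy (true, true); rewrite /F/= !cl; congr is_derive.
  by rewrite /cubic /nsq/=; ring.
Qed.

End Existence.

(** A purely imaginary root of [delta ^+ 2 + k ^+ 2] would make this number real and nonpositive; as
    [delta] has positive real part, it would have to be real, and the number would be positive. *)
Lemma slow_eigenvalue (R : realType) (k : R) (delta : R[i]) :
  0 < k -> 0 < complex.Re delta -> exists e : R[i],
    k%:C%C * k%:C%C = e * (e + 2 * delta) /\ 0 < complex.Re (e + delta).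
Proof.
move=> k0 d0; set s := delta * delta + k%:C%C * k%:C%C.
suff [mu muE mu0] : exists2 mu : R[i], mu * mu = s & 0 < complex.Re mu.
  exists (mu - delta); rewrite subrK; split=> //.
  transitivity (mu * mu - delta * delta); first by rewrite muE /s; ring.
  by ring.
have wE : sqrtc s * sqrtc s = s by rewrite -expr2 sqr_sqrtc.
have [w0|w0|w0] := ltgtP 0 (complex.Re (sqrtc s)); first by exists (sqrtc s).
  by exists (- sqrtc s); rewrite ?mulrNN// raddfN oppr_gt0.
move: wE w0; rewrite /s; case: (sqrtc _) => a b; case: delta d0 {s} => d g /= d0.
move=> /eqP; rewrite eq_complex/= => /andP[/eqP E1 /eqP E2] a0.
exfalso; move: E1 E2; rewrite -a0 => E1 E2.
have g0 : g = 0.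
  have : d * g = 0 by lra.
  by move/eqP; rewrite mulf_eq0 gt_eqF//= => /eqP.
move: E1; rewrite g0; have := (sqr_ge0 b, mulr_gt0 k0 k0, mulr_gt0 d0 d0).
by case=> [[/= b2 k2] d2]; rewrite expr2 in b2; lra.
Qed.

Theorem theorem4p1 (R : realType) (alpha1 alpha2 kappa omega1 omega2 gamma : R)
  (halpha : alpha2 < alpha1) (halpha1 : alpha1 <= 0) (hkappa : 0 < kappa)
  (gammaE : gamma = omega1 - omega2) (hgamma : 0 <= gamma) :
  exists lambda Phi_lim : R,
    0 < lambda /\
    {ae @lebesgue4 R, forall x0 : (R * R) * (R * R),
      (exists z1 z2 : R -> R[i],
         SL_solution alpha1 alpha2 omega1 omega2 kappa x0 z1 z2) /\
      (forall z1 z2 : R -> R[i],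
         SL_solution alpha1 alpha2 omega1 omega2 kappa x0 z1 z2 ->
         [/\ amplitude_death z1 z2,
             exp_decay lambda z1 z2 &
             phase_locking z1 z2 Phi_lim])}.
Proof.
pose delta : R[i] := ((alpha1 - alpha2) / 2 +i* ((omega1 - omega2) / 2))%C.
have delta0 : 0 < complex.Re delta by rewrite /= divr_gt0// subr_gt0.
have k0 : 0 < kappa / 2 by rewrite divr_gt0.
have [e [eE rho0]] := slow_eigenvalue k0 delta0.
have e0 : 0 < nsq e.
  rewrite nsq_gt0//; apply/eqP => e0; move/eqP: eE.
  by rewrite e0 mul0r mulf_eq0 orbb eq_complex/= gt_eqF.
have se0 : 0 < Num.sqrt (nsq e) by rewrite sqrtr_gt0.
have [theta [cosE sinE]] : exists theta, cos theta = complex.Re e / Num.sqrt (nsq e) /\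
    sin theta = - complex.Im e / Num.sqrt (nsq e).
  apply: cos_sin_surj; rewrite !expr_div_n sqrrN -mulrDl -/(nsq e).
  by rewrite sqr_sqrtr ?nsq_ge0// divff// gt_eqF.
pose lambda := SL_rate alpha2 kappa.
have l0 : 0 < lambda by exact: SL_rate_gt0 halpha halpha1 hkappa.
exists lambda, theta; split=> //.
(* [hit] and [dom] range over all solutions issued from [x0], so outside them every solution behaves
   well, without an appeal to uniqueness. *)
pose hit N := [set x0 : (R * R) * (R * R) | exists z1 z2,
    [/\ SL_solution alpha1 alpha2 omega1 omega2 kappa x0 z1 z2,
        nsq (z1 0) + nsq (z2 0) <= N%:R &
        exists2 T, 0 <= T <= N%:R & z1 T = 0 \/ z2 T = 0]].
have hitN N : (@lebesgue4 R).-negligible (hit N).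
  exact: (hits_zero_negligible halpha halpha1 hkappa eE rho0).
have fastP N := fast_dominated_negligible halpha halpha1 hkappa eE rho0 N.
pose n N := projT1 (cid (fastP N)).
pose dom N := [set x0 : (R * R) * (R * R) | exists z1 z2,
    [/\ SL_solution alpha1 alpha2 omega1 omega2 kappa x0 z1 z2,
        nsq (z1 0) + nsq (z2 0) <= N%:R & fast_dominated kappa e (n N) z1 z2]].
have domN N : (@lebesgue4 R).-negligible (dom N).
  by have [] := projT2 (cid (fastP N)).
have bad : (@lebesgue4 R).-negligible (\bigcup_N (hit N `|` dom N)).
  by apply: negligible_bigcup => N; exact: negligibleU.
apply: negligibleS bad => x0 nP; apply: contrapT => nbad; apply: nP.
split; first exact: SL_solution_exists.
move=> z1 z2 Sx; have S := SL_curves_solution Sx.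
set E := nsq (z1 0) + nsq (z2 0).
have E00 : 0 <= E by apply: addr_ge0; exact: nsq_ge0.
have dec : forall t, 0 <= t ->
    Normc.normc (z1 t) <= Num.sqrt E * expR (- (lambda * t)) /\
    Normc.normc (z2 t) <= Num.sqrt E * expR (- (lambda * t)).
  move=> t t0; have := SL_energy_decay halpha halpha1 hkappa S t0; rewrite -/E => H.
  have B0 : 0 <= Num.sqrt E * expR (- (lambda * t)).
    by rewrite mulr_ge0 ?sqrtr_ge0 ?expR_ge0.
  have BE : (Num.sqrt E * expR (- (lambda * t))) ^+ 2 = E * expR (- (2 * lambda) * t).
    rewrite exprMn sqr_sqrtr// [expR _ ^+ 2]expr2 -expRD; congr (_ * expR _); ring.
  have := (nsq_ge0 (z1 t), nsq_ge0 (z2 t)); case=> /= h1 h2.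
  by split; rewrite -(@ler_pXn2r _ 2)// ?nnegrE ?normc_nsq ?sqrtr_ge0// BE
    sqr_sqrtr//; rewrite /lambda; lra.
have cvg0 (f : R -> R) : (forall t, 0 <= f t) -> (forall t, 0 <= t ->
    f t <= Num.sqrt E * expR (- (lambda * t))) -> f t @[t --> +oo] --> (0 : R).
  move=> f0 H; apply: (@cvg_expR_bound R 0 lambda (Num.sqrt E)) => // t t0.
  by rewrite subr0 ger0_norm// mulNr; exact: H.
have n0 z : 0 <= Normc.normc z :> R by rewrite normc_nsq sqrtr_ge0.
(* A single integer above [E + t] bounds both the energy and the hitting time. *)
have noHit t : 0 <= t -> ~ (z1 t = 0 \/ z2 t = 0).
  move=> t0 z0; apply: nbad; pose N := (Num.truncn (E + t)).+1.
  have EN : E + t < N%:R by exact: truncnS_gt.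
  exists N => //; left; exists z1, z2; split=> //; first by rewrite -/E; lra.
  by exists t => //; rewrite t0/=; lra.
have [t0 t00 BA] : exists2 t0, 0 <= t0 & forall t, t0 <= t ->
    nsq (fast kappa e (z1 t) (z2 t)) < nsq (slow kappa e (z1 t) (z2 t)).
  pose N := (Num.truncn E).+1; have EN : E < N%:R by exact: truncnS_gt.
  have [_ H] := projT2 (cid (fastP N)).
  apply: H => //; first exact: ltW.
  by move=> D; apply: nbad; exists N => //; right; exists z1, z2; split=> //; exact: ltW.
split.
- by split; apply: cvg0 => // t /dec[].
- by exists (Num.sqrt E).
- apply: (SL_phase_locking halpha halpha1 hkappa eE rho0 S _ _ t00 BA).
  + by move=> t t0'; apply/eqP => z0; apply: (noHit t t0'); left.
  + by move=> t t0'; apply/eqP => z0; apply: (noHit t t0'); right.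
  + by rewrite cosE divfK// gt_eqF.
  + by rewrite sinE divfK// gt_eqF.
Qed.
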